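(* $$\sum_{k=1}^\infty\frac{S_2(k-1)-\frac{1}{k^2}}{k^4\binom{2k}{k}}=-\frac{313\, \pi^6}{612360}.$$
   Context: $S_2(n):=\sum_{i=1}^n \frac{1}{i^2}$ is the generalized harmonic number of order $2$, with $S_2(0)=0$. *)

(* Defs.v *)
From Stdlib Require Import Reals.
From Coquelicot Require Import Coquelicot.
Open Scope R_scope.

(* [sum_n_m a 1 0] is the empty sum, so [S2 0 = 0]. *)
Definition S2 (n : nat) : R := sum_n_m (fun i : nat => 1 / INR i ^ 2) 1 n.

(* Main.v *)
Require Import Defs.
From Stdlib Require Import Reals Lra Lia.
From Coquelicot Require Import Coquelicot.
Open Scope R_scope.

(** Put x = 4 sin^2 t and L = log (2 sin t), for 0 < t <= PI/6; at t = PI/6 one has x = 1 and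
    L = 0. Differentiating twice in t shows that
      sum x^k / (k^2 C(2k,k)) = 2 t^2   and   sum S2(k-1) x^k / (k^2 C(2k,k)) = (2/3) t^4
    ([arcsin2_sum'_approx], [arcsin4_sum'_approx]). Since dx/x = 2 dL, the further factors 1/k^2
    and 1/k^4 are obtained by integrating against powers of L, and the sum of the theorem becomes
      integral from 0 to PI/6 of (16/3) t^3 L^2 - (8/3) t L^4
        = - (8/15) * integral from 0 to PI/6 of Im (L + i t)^5 - t^5.
    The combination S2(k-1) - 1/k^2 is the one for which only this imaginary part occurs.

    Now L + i t is the logarithm of i (1 - exp (2 i t)). With u = 1 - exp (2 i t), which runs from
    0 to exp (- i PI/3) in the unit disc, the integral of (L + i t)^5 dt is i/2 times the integral
    of a fifth power of a logarithm against du/(1-u). Expanding 1/(1-u) gives a combination of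
    polylogarithms of u, of orders 1 to 6 ([is_derive_arc_sum]). At the end point L + i t is purely
    imaginary and the required part involves only the sums of sin(n PI/3)/n^m for m odd and of
    cos(n PI/3)/n^m for m even ([arc_sum_PI6]). These are values of Bernoulli polynomials
    ([sawtooth_rate], [bernoulli_fourier]), hence rational multiples of powers of PI, and every
    product has total weight 6.

    No integral is formed. The primitives are written explicitly on partial sums, and [potential]
    is the difference of the two sides of the identity above, truncated at N. Its derivative is
    small ([potential_derive_bound]) and it tends to 0 with t ([potential_small]), so its value at
    PI/6, a partial sum of the series plus a quantity with known limit, tends to 0 as N grows
    ([potential_PI6_small]). *)

(** * Increments, termwise derivatives, limits *)

(** All series are kept as partial sums; passing to the limit then amounts to integrating an error
    in the derivative, which is done by comparison with an explicit primitive [g]. *)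
Lemma increment_le_of_derive_le (f g f' g' : R -> R) (a b : R) :
  a <= b ->
  (forall x, a <= x <= b -> is_derive f x (f' x)) ->
  (forall x, a <= x <= b -> is_derive g x (g' x)) ->
  (forall x, a < x < b -> Rabs (f' x) <= g' x) ->
  Rabs (f b - f a) <= g b - g a.
Proof.
  intros Hab Hf Hg Hfg.
  destruct (Req_dec a b) as [<-|Hne].
  { rewrite !Rminus_diag, Rabs_R0; lra. }
  assert (Hlt : a < b) by lra.
  assert (H1 : exists c, (g b - f b) - (g a - f a) = (g' c - f' c) * (b - a) /\ a < c < b).
  { apply (MVT_cor2 (fun x => g x - f x) (fun x => g' x - f' x)); [exact Hlt|].
    intros c Hc; apply is_derive_Reals.
    apply (is_derive_minus g f); auto. }
  assert (H2 : exists c, (g b + f b) - (g a + f a) = (g' c + f' c) * (b - a) /\ a < c < b).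
  { apply (MVT_cor2 (fun x => g x + f x) (fun x => g' x + f' x)); [exact Hlt|].
    intros c Hc; apply is_derive_Reals.
    apply (is_derive_plus g f); auto. }
  destruct H1 as (c1 & E1 & Hc1), H2 as (c2 & E2 & Hc2).
  generalize (Hfg c1 Hc1) (Hfg c2 Hc2); intros B1 B2.
  apply Rabs_le_between in B1; apply Rabs_le_between in B2.
  apply Rabs_le; split; nra.
Qed.

Lemma sum_n_0 (a : nat -> R) : sum_n a O = a O.
Proof. exact (sum_O a). Qed.

Lemma sum_n_S (a : nat -> R) (N : nat) : sum_n a (S N) = sum_n a N + a (S N).
Proof. exact (sum_Sn a N). Qed.

Lemma is_derive_sum_at (F : nat -> R -> R) (d : nat -> R) (N : nat) (x : R) :
  (forall n, is_derive (F n) x (d n)) ->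
  is_derive (fun t => sum_n (fun n => F n t) N) x (sum_n d N).
Proof.
  intros H; induction N as [|N IH].
  - apply (is_derive_ext (F O)); [intros t; now rewrite sum_n_0|].
    rewrite sum_n_0; apply H.
  - apply (is_derive_ext (fun t => sum_n (fun n => F n t) N + F (S N) t));
      [intros t; now rewrite sum_n_S|].
    rewrite sum_n_S; apply (is_derive_plus (fun t => sum_n (fun n => F n t) N) (F (S N))); auto.
Qed.

Lemma is_derive_sum (F F' : nat -> R -> R) (N : nat) (x : R) :
  (forall n, is_derive (F n) x (F' n x)) ->
  is_derive (fun t => sum_n (fun n => F n t) N) x (sum_n (fun n => F' n x) N).
Proof. apply is_derive_sum_at. Qed.

Lemma is_derive_linear (k x : R) : is_derive (fun t => k * t) x k.
Proof. auto_derive; [trivial|ring]. Qed.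

Lemma is_lim_seq_const_div_S (K : R) : is_lim_seq (fun N => K / INR (S N)) 0.
Proof.
  replace (Finite 0) with (Rbar_mult K 0) by (simpl; f_equal; ring).
  apply is_lim_seq_scal_l.
  apply (is_lim_seq_incr_1 (fun N => / INR N)).
  replace (Finite 0) with (Rbar_inv p_infty) by reflexivity.
  apply is_lim_seq_inv; [apply is_lim_seq_INR|easy].
Qed.

Lemma is_lim_seq_of_abs_le (u e : nat -> R) (l : R) :
  (forall N, Rabs (u N - l) <= e N) -> is_lim_seq e 0 -> is_lim_seq u l.
Proof.
  intros H He.
  apply (is_lim_seq_ext (fun N => (u N - l) + l)); [intros; ring|].
  replace (Finite l) with (Finite (0 + l)) by (f_equal; ring).
  apply is_lim_seq_plus'; [|apply is_lim_seq_const].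
  apply is_lim_seq_abs_0.
  apply (is_lim_seq_le_le (fun _ => 0) _ e); auto.
  - intros N; split; [apply Rabs_pos|apply H].
  - apply is_lim_seq_const.
Qed.

Lemma INR_S_pos (n : nat) : 0 < INR (S n).
Proof. apply lt_0_INR; lia. Qed.

Lemma INR_S_ge_1 (n : nat) : 1 <= INR (S n).
Proof. rewrite S_INR; generalize (pos_INR n); lra. Qed.

(** * Fourier series of the Bernoulli polynomials *)

Definition cos_sum (m N : nat) (t : R) : R :=
  sum_n (fun n => cos (INR (S n) * t) / INR (S n) ^ m) N.

Definition sin_sum (m N : nat) (t : R) : R :=
  sum_n (fun n => sin (INR (S n) * t) / INR (S n) ^ m) N.

(** The interval is open because the limit of [cos_sum 2] is identified through its derivative,
    the sawtooth, which jumps at 0. *)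
Definition uniform_limit (F : nat -> R -> R) (G : R -> R) : Prop :=
  exists e : nat -> R, is_lim_seq e 0 /\
    forall N t, 0 < t < PI -> Rabs (F N t - G t) <= e N.

Lemma is_derive_sin_sum (m N : nat) (t : R) :
  is_derive (sin_sum (S m) N) t (cos_sum m N t).
Proof.
  apply (is_derive_sum (fun n x => sin (INR (S n) * x) / INR (S n) ^ S m)
                       (fun n x => cos (INR (S n) * x) / INR (S n) ^ m)).
  intros n; generalize (INR_S_pos n); generalize (INR (S n)); intros k Hk.
  auto_derive; [trivial|].
  simpl; field; split; [apply pow_nonzero|]; lra.
Qed.

Lemma is_derive_cos_sum (m N : nat) (t : R) :
  is_derive (cos_sum (S m) N) t (- sin_sum m N t).
Proof.
  assert (E : - sin_sum m N t = sum_n (fun n => - (sin (INR (S n) * t) / INR (S n) ^ m)) N).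
  { unfold sin_sum; induction N as [|N IH];
      [now rewrite !sum_n_0|rewrite !sum_n_S, <- IH; ring]. }
  rewrite E.
  apply (is_derive_sum (fun n x => cos (INR (S n) * x) / INR (S n) ^ S m)
                       (fun n x => - (sin (INR (S n) * x) / INR (S n) ^ m))).
  intros n; generalize (INR_S_pos n); generalize (INR (S n)); intros k Hk.
  auto_derive; [trivial|].
  simpl; field; split; [apply pow_nonzero|]; lra.
Qed.

Lemma sin_INR_PI (n : nat) : sin (INR n * PI) = 0.
Proof.
  rewrite <- (Rplus_0_l (INR n * PI)).
  induction n as [|n IH]; [simpl; rewrite Rmult_0_l, Rplus_0_r; apply sin_0|].
  rewrite S_INR.
  replace (0 + (INR n + 1) * PI) with ((0 + INR n * PI) + PI) by ring.
  rewrite neg_sin, IH; ring.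
Qed.

Lemma sin_sum_0 (m N : nat) : sin_sum m N 0 = 0.
Proof.
  unfold sin_sum; induction N as [|N IH];
    [rewrite sum_n_0|rewrite sum_n_S, IH];
    rewrite Rmult_0_r, sin_0; unfold Rdiv; simpl; ring.
Qed.

Lemma sin_sum_PI (m N : nat) : sin_sum m N PI = 0.
Proof.
  unfold sin_sum; induction N as [|N IH];
    [rewrite sum_n_0|rewrite sum_n_S, IH];
    rewrite sin_INR_PI; unfold Rdiv; simpl; ring.
Qed.

Lemma dirichlet_kernel (N : nat) (t : R) :
  2 * sin (t / 2) * cos_sum 0 N t = sin ((INR (S N) + / 2) * t) - sin (t / 2).
Proof.
  assert (P : forall k, 2 * sin (t / 2) * cos (k * t)
                        = sin ((k + / 2) * t) - sin ((k - / 2) * t)).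
  { intros k.
    replace ((k + / 2) * t) with (k * t + t / 2) by field.
    replace ((k - / 2) * t) with (k * t - t / 2) by field.
    rewrite sin_plus, sin_minus; ring. }
  unfold cos_sum; induction N as [|N IH].
  - rewrite sum_n_0. simpl pow. unfold Rdiv at 2. rewrite Rinv_1, Rmult_1_r, P.
    simpl INR. replace ((1 - / 2) * t) with (t / 2) by field. reflexivity.
  - rewrite sum_n_S.
    rewrite Rmult_plus_distr_l, IH.
    simpl pow; unfold Rdiv at 3; rewrite Rinv_1, Rmult_1_r, P.
    rewrite (S_INR (S N)).
    replace (INR (S N) + 1 - / 2) with (INR (S N) + / 2) by field.
    ring.
Qed.

(** Adding [r t = cos ((N + 3/2) t) / ((2 N + 3) sin (t/2))] to the partial sum cancels the leading
    oscillation of the Dirichlet kernel, so that the derivative of the corrected sum differs from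
    [- 1/2] by O(1/N) away from 0. Integrate from [t] to [PI], where the sum and [r] both vanish. *)
Lemma sawtooth_rate (d : R) : 0 < d ->
  exists K, 0 <= K /\ forall N t, d <= t <= PI ->
    Rabs (sin_sum 1 N t - (PI - t) / 2) <= K / INR (S N).
Proof.
  intros Hd.
  destruct (Rle_lt_dec d PI) as [HdP|HdP].
  2:{ exists 0; split; [lra|intros; exfalso; lra]. }
  assert (Hs : 0 < sin (d / 2)) by (apply sin_gt_0; lra).
  set (s := sin (d / 2)) in *.
  assert (Hst : forall t, d <= t <= PI -> s <= sin (t / 2)).
  { intros t Ht; unfold s; apply sin_incr_1; lra. }
  exists (PI * / (s ^ 2) + / s); split.
  { generalize (Rinv_0_lt_compat s Hs) (Rinv_0_lt_compat (s^2) (pow_lt s 2 Hs)) PI_RGT_0.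
    intros; nra. }
  intros N t Ht.
  set (k := INR (S N) + / 2).
  assert (Hk : 0 < INR (S N)) by apply INR_S_pos.
  assert (Hk1 : INR (S N) <= k) by (unfold k; lra).
  set (r := fun x => cos (k * x) / (2 * k * sin (x / 2))).
  assert (Hr : forall x, d <= x <= PI -> Rabs (r x) <= / (2 * (INR (S N)) * s)).
  { intros x Hx; unfold r. generalize (Hst x Hx); intros Hsx.
    rewrite Rabs_div by (apply Rgt_not_eq; nra).
    rewrite (Rabs_pos_eq (2 * k * sin (x / 2))) by nra.
    unfold Rdiv; rewrite <- (Rmult_1_l (/ (2 * INR (S N) * s))).
    apply Rmult_le_compat; [apply Rabs_pos|left; apply Rinv_0_lt_compat; nra| |].
    - apply Rabs_le; apply COS_bound.
    - apply Rinv_le_contravar; [nra|].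
      apply Rmult_le_compat; nra. }
  assert (B : Rabs ((sin_sum 1 N PI + PI / 2 + r PI) - (sin_sum 1 N t + t / 2 + r t))
              <= / (4 * INR (S N) * s ^ 2) * PI - / (4 * INR (S N) * s ^ 2) * t).
  { apply (increment_le_of_derive_le (fun x => sin_sum 1 N x + x / 2 + r x)
       (fun x => / (4 * INR (S N) * s ^ 2) * x)
       (fun x => - (cos (k * x) * cos (x / 2)) / (4 * k * sin (x / 2) ^ 2))
       (fun x => / (4 * INR (S N) * s ^ 2))); [lra| | |].
    - intros x Hx; generalize (Hst x (conj (Rle_trans _ _ _ (proj1 Ht) (proj1 Hx)) (proj2 Hx)));
        intros Hsx.
      assert (D0 : cos_sum 0 N x = (sin (k * x) - sin (x / 2)) / (2 * sin (x / 2))).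
      { unfold k; rewrite <- dirichlet_kernel; field; lra. }
      replace (- (cos (k * x) * cos (x / 2)) / (4 * k * sin (x / 2) ^ 2))
        with (cos_sum 0 N x + (/ 2 + (- k * sin (k * x) / (2 * k * sin (x / 2))
                - cos (k * x) * cos (x / 2) / (4 * k * sin (x / 2) ^ 2))))
        by (rewrite D0; field; split; lra).
      apply (is_derive_ext (fun x => sin_sum 1 N x + (x / 2 + r x)));
        [intros y; symmetry; apply Rplus_assoc|].
      apply (is_derive_plus (sin_sum 1 N) (fun x => x / 2 + r x)).
      + apply is_derive_sin_sum.
      + unfold r; auto_derive; change (x * / 2) with (x / 2); [apply Rgt_not_eq; nra|].
        field; split; lra.
    - intros x _; apply is_derive_linear.
    - intros x Hx.
      assert (Hsx : s <= sin (x / 2)) by (apply Hst; lra).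
      assert (Hs2 : s ^ 2 <= sin (x / 2) ^ 2) by (apply pow_incr; lra).
      assert (0 < s ^ 2) by (apply pow_lt; lra).
      assert (0 < 4 * k * sin (x / 2) ^ 2) by (apply Rmult_lt_0_compat; lra).
      rewrite Rabs_div by lra.
      rewrite Rabs_Ropp, Rabs_mult, (Rabs_pos_eq (4 * k * sin (x / 2) ^ 2)) by lra.
      unfold Rdiv; rewrite <- (Rmult_1_l (/ (4 * INR (S N) * s ^ 2))).
      apply Rmult_le_compat; [apply Rmult_le_pos; apply Rabs_pos|left; apply Rinv_0_lt_compat; nra| |].
      + rewrite <- (Rmult_1_l 1); apply Rmult_le_compat; try apply Rabs_pos;
          apply Rabs_le; apply COS_bound.
      + apply Rinv_le_contravar; [nra|].
        apply Rmult_le_compat; try nra. }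
  rewrite sin_sum_PI in B.
  assert (Z : r PI = 0).
  { unfold r. replace (k * PI) with (INR (S N) * PI + PI / 2) by (unfold k; field).
    rewrite cos_plus, cos_PI2, sin_INR_PI; unfold Rdiv; ring. }
  rewrite Z in B.
  assert (Hrt := Hr t (conj (proj1 Ht) (proj2 Ht))).
  assert (E1 : / (2 * INR (S N) * s) = / s / INR (S N) / 2) by (field; split; lra).
  assert (E2 : / (4 * INR (S N) * s ^ 2) = / s ^ 2 / INR (S N) / 4) by (field; split; lra).
  rewrite E1 in Hrt; rewrite E2 in B.
  unfold Rdiv at 2; rewrite Rmult_plus_distr_r.
  assert (P1 : 0 < / s / INR (S N)) by (apply Rdiv_lt_0_compat; [apply Rinv_0_lt_compat|]; lra).
  assert (P2 : 0 < / s ^ 2 / INR (S N))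
    by (apply Rdiv_lt_0_compat; [apply Rinv_0_lt_compat; nra|lra]).
  fold (Rdiv (/ s) (INR (S N))).
  replace (PI * / s ^ 2 * / INR (S N)) with (PI * (/ s ^ 2 / INR (S N))) by (unfold Rdiv; ring).
  apply Rabs_le_between in B; apply Rabs_le_between in Hrt.
  assert (P3 : 0 <= / s ^ 2 / INR (S N) * t) by nra.
  generalize PI_RGT_0; intros.
  apply Rabs_le; split; nra.
Qed.

(** Compare with the telescoping series of [1/(k (k+1))]. *)
Lemma tail_inv_sqr (u : nat -> R) (N p : nat) :
  (forall n, Rabs (u n) <= / INR (S n) ^ 2) ->
  Rabs (sum_n u (N + p) - sum_n u N) <= / INR (S N) - / INR (S (N + p)).
Proof.
  intros Hu; induction p as [|p IH].
  - rewrite Nat.add_0_r, !Rminus_diag, Rabs_R0; lra.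
  - rewrite Nat.add_succ_r, sum_n_S.
    replace (sum_n u (N + p) + u (S (N + p)) - sum_n u N)
      with ((sum_n u (N + p) - sum_n u N) + u (S (N + p))) by ring.
    eapply Rle_trans; [apply Rabs_triang|].
    generalize (Hu (S (N + p))).
    rewrite (S_INR (S (N + p))).
    generalize (INR_S_pos (N + p)); revert IH.
    generalize (INR (S (N + p))); intros k IH Hk H.
    assert (/ (k + 1) ^ 2 <= / k - / (k + 1)).
    { replace (/ k - / (k + 1)) with (/ (k * (k + 1))) by (field; split; lra).
      apply Rinv_le_contravar; nra. }
    lra.
Qed.

Lemma ex_lim_inv_sqr (u : nat -> R) :
  (forall n, Rabs (u n) <= / INR (S n) ^ 2) ->
  exists l : R, is_lim_seq (sum_n u) l /\ forall N, Rabs (sum_n u N - l) <= / INR (S N).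
Proof.
  intros Hu.
  assert (H : ex_finite_lim_seq (sum_n u)).
  { apply ex_lim_seq_cauchy_corr; intros eps.
    assert (L := is_lim_seq_const_div_S 1).
    apply is_lim_seq_spec in L; destruct (L eps) as [N0 HN0].
    assert (T : forall n m, (N0 <= n)%nat -> (n <= m)%nat -> Rabs (sum_n u m - sum_n u n) < eps).
    { intros n m Hn Hm; replace m with (n + (m - n))%nat by lia.
      generalize (tail_inv_sqr u n (m - n) Hu) (HN0 n Hn).
      generalize (Rinv_0_lt_compat _ (INR_S_pos (n + (m - n)))) (Rinv_0_lt_compat _ (INR_S_pos n)).
      intros A A' B C; rewrite Rminus_0_r, Rabs_pos_eq in C by (unfold Rdiv; lra).
      unfold Rdiv in C; lra. }
    exists N0; intros n m Hn Hm.
    destruct (Nat.le_ge_cases n m) as [Hnm|Hnm].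
    - rewrite Rabs_minus_sym; apply T; auto.
    - apply T; auto. }
  destruct H as [l Hl]; exists l; split; [exact Hl|].
  intros N; rewrite Rabs_minus_sym.
  assert (L : is_lim_seq (fun p => Rabs (sum_n u (p + N) - sum_n u N)) (Rabs (l - sum_n u N))).
  { apply (is_lim_seq_abs _ (Finite (l - sum_n u N))).
    apply is_lim_seq_minus'; [|apply is_lim_seq_const].
    now apply (is_lim_seq_incr_n (sum_n u)). }
  apply (is_lim_seq_le (fun p => Rabs (sum_n u (p + N) - sum_n u N))
    (fun _ => / INR (S N)) (Finite (Rabs (l - sum_n u N)))
    (Finite (/ INR (S N)))); [|exact L|apply is_lim_seq_const].
  intros p; rewrite Nat.add_comm.
  generalize (tail_inv_sqr u N p Hu) (Rinv_0_lt_compat _ (INR_S_pos (N + p))); lra.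
Qed.

Lemma cos_term_le (m n : nat) (t : R) :
  (2 <= m)%nat -> Rabs (cos (INR (S n) * t) / INR (S n) ^ m) <= / INR (S n) ^ 2.
Proof.
  intros Hm.
  assert (H1 : 1 <= INR (S n)) by (rewrite S_INR; generalize (pos_INR n); lra).
  assert (H2 : INR (S n) ^ 2 <= INR (S n) ^ m) by (apply Rle_pow; auto).
  assert (H3 : 0 < INR (S n) ^ 2) by (apply pow_lt; lra).
  rewrite Rabs_div by lra.
  rewrite (Rabs_pos_eq (INR (S n) ^ m)) by lra.
  unfold Rdiv; rewrite <- (Rmult_1_l (/ INR (S n) ^ 2)).
  apply Rmult_le_compat; [apply Rabs_pos|left; apply Rinv_0_lt_compat; lra| |].
  - apply Rabs_le; apply COS_bound.
  - apply Rinv_le_contravar; lra.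
Qed.

(** The limit is identified by integrating [sawtooth_rate] from [t] to [PI]; the
    rate degenerates as [t] tends to 0, but the tails of the cosine series are bounded by [1/N] for every [t], which gives
    uniformity on the whole interval. *)
Lemma cos_sum_2_uniform :
  exists c, uniform_limit (cos_sum 2) (fun t => t ^ 2 / 4 - PI * t / 2 + c).
Proof.
  assert (Hu : forall t n, Rabs (cos (INR (S n) * t) / INR (S n) ^ 2) <= / INR (S n) ^ 2)
    by (intros; now apply cos_term_le).
  destruct (ex_lim_inv_sqr _ (Hu PI)) as (l & Hl & _).
  exists (l + PI ^ 2 / 4), (fun N => 1 / INR (S N)); split; [apply is_lim_seq_const_div_S|].
  intros N t Ht.
  destruct (ex_lim_inv_sqr _ (Hu t)) as (lt & Hlt & Bt).
  replace (t ^ 2 / 4 - PI * t / 2 + (l + PI ^ 2 / 4)) with lt;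
    [unfold Rdiv; rewrite Rmult_1_l; apply Bt|].
  destruct (sawtooth_rate t (proj1 Ht)) as (K & HK & B).
  set (E := fun M x => cos_sum 2 M x - (x ^ 2 / 4 - PI * x / 2)).
  assert (L1 : is_lim_seq (fun M => E M PI - E M t)
     (l - (PI ^ 2 / 4 - PI * PI / 2) - (lt - (t ^ 2 / 4 - PI * t / 2)))).
  { apply is_lim_seq_minus'; apply is_lim_seq_minus'; auto; apply is_lim_seq_const. }
  assert (L2 : is_lim_seq (fun M => E M PI - E M t) 0).
  { apply (is_lim_seq_of_abs_le _ (fun M => (K * (PI - t)) / INR (S M)));
      [|apply is_lim_seq_const_div_S].
    intros M; rewrite Rminus_0_r.
    replace (K * (PI - t) / INR (S M)) with (K / INR (S M) * PI - K / INR (S M) * t)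
      by (unfold Rdiv; ring).
    apply (increment_le_of_derive_le (E M) (fun x => K / INR (S M) * x)
      (fun x => - sin_sum 1 M x - (x / 2 - PI / 2)) (fun _ => K / INR (S M))); [lra| | |].
    - intros x _; apply (is_derive_minus (cos_sum 2 M)); [apply is_derive_cos_sum|].
      auto_derive; [trivial|field].
    - intros x _; apply is_derive_linear.
    - intros x Hx; rewrite <- Rabs_Ropp.
      replace (- (- sin_sum 1 M x - (x / 2 - PI / 2))) with (sin_sum 1 M x - (PI - x) / 2) by field.
      apply B; lra. }
  assert (E0 := is_lim_seq_unique _ _ L1); rewrite (is_lim_seq_unique _ _ L2) in E0.
  injection E0; lra.
Qed.

Lemma integrate_uniform_limit (F F' : nat -> R -> R) (G Q : R -> R) :
  (forall N t, is_derive (F N) t (F' N t)) -> (forall t, is_derive Q t (G t)) ->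
  uniform_limit F' G ->
  exists e, is_lim_seq e 0 /\
    forall N t, 0 <= t <= PI -> Rabs ((F N t - Q t) - (F N 0 - Q 0)) <= e N.
Proof.
  intros HF HQ (e & He & B).
  exists (fun N => PI * Rabs (e N)); split.
  { replace (Finite 0) with (Rbar_mult PI 0) by (simpl; f_equal; ring).
    apply is_lim_seq_scal_l; apply -> is_lim_seq_abs_0; exact He. }
  intros N t Ht.
  apply Rle_trans with (Rabs (e N) * t - Rabs (e N) * 0).
  - apply (increment_le_of_derive_le (fun x => F N x - Q x) (fun x => Rabs (e N) * x)
      (fun x => F' N x - G x) (fun _ => Rabs (e N))); [lra| | |].
    + intros x _; apply (is_derive_minus (F N) Q); auto.
    + intros x _; apply is_derive_linear.
    + intros x Hx; eapply Rle_trans; [apply B; lra|apply Rle_abs].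
  - generalize (Rabs_pos (e N)); nra.
Qed.

(** The unknown constant of integration is recovered from the vanishing of every sine sum at
    [PI], so no value of the zeta function has to be known beforehand. *)
Lemma sin_sum_step (m : nat) (p q : R -> R) (c : R) :
  (forall t, is_derive q t (p t)) -> q 0 = 0 ->
  uniform_limit (cos_sum m) (fun t => p t + c) ->
  uniform_limit (sin_sum (S m)) (fun t => q t + c * t) /\ q PI + c * PI = 0.
Proof.
  intros Hq Hq0 HU.
  destruct (integrate_uniform_limit (sin_sum (S m)) (cos_sum m) (fun t => p t + c)
              (fun t => q t + c * t)) as (e & He & B); auto.
  { intros; apply is_derive_sin_sum. }
  { intros t; apply (is_derive_plus q); [apply Hq|auto_derive; [trivial|ring]]. }
  assert (B' : forall N t, 0 <= t <= PI -> Rabs (sin_sum (S m) N t - (q t + c * t)) <= e N).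
  { intros N t Ht; replace (sin_sum (S m) N t - (q t + c * t))
      with ((sin_sum (S m) N t - (q t + c * t)) - (sin_sum (S m) N 0 - (q 0 + c * 0)))
      by (rewrite sin_sum_0, Hq0; ring).
    apply B; auto. }
  split.
  - exists e; split; auto; intros; apply B'; lra.
  - assert (L : is_lim_seq (fun N => sin_sum (S m) N PI) (q PI + c * PI)).
    { apply (is_lim_seq_of_abs_le _ e); auto; intros N; apply B'.
      generalize PI_RGT_0; lra. }
    assert (E := is_lim_seq_unique _ _ L).
    rewrite (Lim_seq_ext _ (fun _ => 0)), Lim_seq_const in E by (intros; apply sin_sum_PI).
    now injection E.
Qed.

(** The new constant is the limit of the sum at 0, that is zeta(m+1). It is left unspecified here
    and is determined by [sin_sum_step] one order higher. *)
Lemma cos_sum_step (m : nat) (p q : R -> R) :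
  (1 <= m)%nat ->
  (forall t, is_derive q t (- p t)) -> q 0 = 0 ->
  uniform_limit (sin_sum m) p ->
  exists c, uniform_limit (cos_sum (S m)) (fun t => q t + c).
Proof.
  intros Hm Hq Hq0 (e0 & He0 & B0).
  destruct (integrate_uniform_limit (cos_sum (S m)) (fun N t => - sin_sum m N t)
              (fun t => - p t) q) as (e & He & B); auto.
  { intros; apply is_derive_cos_sum. }
  { exists e0; split; auto; intros N t Ht; rewrite <- Rabs_Ropp.
    replace (- (- sin_sum m N t - - p t)) with (sin_sum m N t - p t) by ring; auto. }
  destruct (ex_lim_inv_sqr (fun n => cos (INR (S n) * 0) / INR (S n) ^ S m)) as (c & _ & Bc).
  { intros n; apply cos_term_le; lia. }
  exists c, (fun N => e N + 1 / INR (S N)); split.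
  { replace (Finite 0) with (Finite (0 + 0)) by (f_equal; ring).
    apply is_lim_seq_plus'; [exact He|apply is_lim_seq_const_div_S]. }
  intros N t Ht.
  replace (cos_sum (S m) N t - (q t + c))
    with ((cos_sum (S m) N t - q t - (cos_sum (S m) N 0 - q 0)) + (cos_sum (S m) N 0 - c))
    by (rewrite Hq0; ring).
  eapply Rle_trans; [apply Rabs_triang|].
  apply Rplus_le_compat; [apply B; lra|].
  unfold Rdiv; rewrite Rmult_1_l; apply Bc.
Qed.

Lemma uniform_limit_at (F : nat -> R -> R) (G : R -> R) (t : R) :
  uniform_limit F G -> 0 < t < PI -> is_lim_seq (fun N => F N t) (G t).
Proof.
  intros (e & He & B) Ht; apply (is_lim_seq_of_abs_le _ e); auto.
Qed.

Lemma uniform_limit_ext (F : nat -> R -> R) (G H : R -> R) :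
  (forall t, G t = H t) -> uniform_limit F G -> uniform_limit F H.
Proof.
  intros E (e & He & B); exists e; split; auto; intros; rewrite <- E; auto.
Qed.

(** One integration beyond order 6 is needed to fix the constant of order 6. *)
Lemma bernoulli_fourier :
  uniform_limit (cos_sum 2) (fun t => t ^ 2 / 4 - PI * t / 2 + PI ^ 2 / 6) /\
  uniform_limit (sin_sum 3) (fun t => t ^ 3 / 12 - PI * t ^ 2 / 4 + PI ^ 2 * t / 6) /\
  uniform_limit (cos_sum 4)
    (fun t => - t ^ 4 / 48 + PI * t ^ 3 / 12 - PI ^ 2 * t ^ 2 / 12 + PI ^ 4 / 90) /\
  uniform_limit (sin_sum 5)
    (fun t => - t ^ 5 / 240 + PI * t ^ 4 / 48 - PI ^ 2 * t ^ 3 / 36 + PI ^ 4 * t / 90) /\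
  uniform_limit (cos_sum 6)
    (fun t => t ^ 6 / 1440 - PI * t ^ 5 / 240 + PI ^ 2 * t ^ 4 / 144 - PI ^ 4 * t ^ 2 / 180
              + PI ^ 6 / 945).
Proof.
  assert (HP := PI_RGT_0).
  set (p2 := fun t => t ^ 2 / 4 - PI * t / 2).
  set (p3 := fun t => t ^ 3 / 12 - PI * t ^ 2 / 4).
  set (p4 := fun t => - t ^ 4 / 48 + PI * t ^ 3 / 12 - PI ^ 2 * t ^ 2 / 12).
  set (p5 := fun t => - t ^ 5 / 240 + PI * t ^ 4 / 48 - PI ^ 2 * t ^ 3 / 36).
  set (p6 := fun t => t ^ 6 / 1440 - PI * t ^ 5 / 240 + PI ^ 2 * t ^ 4 / 144
                      - PI ^ 4 * t ^ 2 / 180).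
  set (p7 := fun t => t ^ 7 / 10080 - PI * t ^ 6 / 1440 + PI ^ 2 * t ^ 5 / 720
                      - PI ^ 4 * t ^ 3 / 540).
  destruct cos_sum_2_uniform as (c & H2).
  change (uniform_limit (cos_sum 2) (fun t => p2 t + c)) in H2.
  destruct (sin_sum_step 2 p2 p3 c) as [H3 E2]; [|unfold p3; field|exact H2|].
  { intros t; unfold p2, p3; auto_derive; [trivial|field]. }
  assert (c = PI ^ 2 / 6) by (apply (Rmult_eq_reg_r PI); unfold p3 in E2; lra); subst c; clear E2.
  destruct (cos_sum_step 3 (fun t => p3 t + PI ^ 2 / 6 * t) p4)
    as [c H4]; [lia| |unfold p4; field|exact H3|].
  { intros t; unfold p3, p4; auto_derive; [trivial|field]. }
  destruct (sin_sum_step 4 p4 p5 c) as [H5 E4]; [|unfold p5; field|exact H4|].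
  { intros t; unfold p4, p5; auto_derive; [trivial|field]. }
  assert (c = PI ^ 4 / 90) by (apply (Rmult_eq_reg_r PI); unfold p5 in E4; lra); subst c; clear E4.
  destruct (cos_sum_step 5 (fun t => p5 t + PI ^ 4 / 90 * t) p6)
    as [c H6]; [lia| |unfold p6; field|exact H5|].
  { intros t; unfold p5, p6; auto_derive; [trivial|field]. }
  destruct (sin_sum_step 6 p6 p7 c) as [_ E6]; [|unfold p7; field|exact H6|].
  { intros t; unfold p6, p7; auto_derive; [trivial|field]. }
  assert (c = PI ^ 6 / 945) by (apply (Rmult_eq_reg_r PI); unfold p7 in E6; lra); subst c; clear E6.
  repeat split; eapply uniform_limit_ext; try eassumption; intros t; unfold p2, p3, p4, p5, p6; field.
Qed.

(** * Even powers of the arcsine as central binomial series *)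

Definition central_binom (k : nat) : R := Binomial.C (2 * k) k.

Lemma central_binom_0 : central_binom 0 = 1.
Proof. unfold central_binom, Binomial.C; simpl; field. Qed.

Lemma central_binom_S (k : nat) :
  central_binom (S k) = central_binom k * (2 * (2 * INR k + 1)) / INR (S k).
Proof.
  unfold central_binom, Binomial.C.
  replace (2 * S k - S k)%nat with (S k) by lia.
  replace (2 * k - k)%nat with k by lia.
  replace (2 * S k)%nat with (S (S (2 * k))) by lia.
  rewrite !fact_simpl, !mult_INR, !S_INR, mult_INR.
  change (INR 2) with 2.
  generalize (pos_INR k) (INR_fact_neq_0 k); intros; field; split; lra.
Qed.

Lemma central_binom_ge (k : nat) : INR (S k) <= central_binom k.
Proof.
  induction k as [|k IH]; [rewrite central_binom_0; simpl; lra|].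
  rewrite central_binom_S.
  assert (Hk := pos_INR k); rewrite (S_INR (S k)), (S_INR k) in *.
  apply Rle_trans with ((INR k + 1) * (2 * (2 * INR k + 1)) / (INR k + 1)).
  - replace ((INR k + 1) * (2 * (2 * INR k + 1)) / (INR k + 1)) with (2 * (2 * INR k + 1))
      by (field; lra).
    destruct k as [|k]; [simpl; lra|rewrite S_INR in *; generalize (pos_INR k); lra].
  - apply Rmult_le_compat_r; [left; apply Rinv_0_lt_compat; lra|].
    apply Rmult_le_compat_r; lra.
Qed.

Lemma S2_0 : S2 0 = 0.
Proof. unfold S2; now rewrite sum_n_m_zero by lia. Qed.

Lemma S2_S (n : nat) : S2 (S n) = S2 n + 1 / INR (S n) ^ 2.
Proof. unfold S2; rewrite sum_n_Sm by lia; reflexivity. Qed.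

Lemma S2_bounds (n : nat) : 0 <= S2 n <= 2.
Proof.
  split.
  - induction n as [|n IH]; [rewrite S2_0; lra|rewrite S2_S].
    assert (0 < 1 / INR (S n) ^ 2)
      by (apply Rdiv_lt_0_compat; [lra|apply pow_lt, INR_S_pos]); lra.
  - destruct n as [|n]; [rewrite S2_0; lra|].
    assert (H : S2 (S n) <= 2 - / INR (S n)).
    { induction n as [|n IH]; [rewrite S2_S, S2_0; simpl; lra|].
      rewrite S2_S; generalize (INR_S_pos n) IH; rewrite (S_INR (S n)).
      generalize (INR (S n)); intros k Hk B.
      assert (1 / (k + 1) ^ 2 <= / k - / (k + 1)).
      { replace (/ k - / (k + 1)) with (1 / (k * (k + 1))) by (field; split; lra).
        unfold Rdiv; rewrite !Rmult_1_l; apply Rinv_le_contravar; nra. }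
      lra. }
    generalize (Rinv_0_lt_compat _ (INR_S_pos n)); lra.
Qed.

(** The squared length of the chord joining 1 to [exp (2 i t)]; it is the variable of the central
    binomial series and equals 1 at [PI/6]. *)
Definition chord_sq (t : R) : R := (2 * sin t) ^ 2.

Definition chord_pow (n : nat) (t : R) : R := chord_sq t ^ S n.

Definition chord_pow' (n : nat) (t : R) : R :=
  INR (S n) * chord_sq t ^ n * (8 * sin t * cos t).

Definition chord_pow'' (n : nat) (t : R) : R :=
  INR (S n) * chord_sq t ^ n * (8 * (2 * INR n + 1) - 4 * INR (S n) * chord_sq t).

Lemma is_derive_chord_sq (t : R) : is_derive chord_sq t (8 * sin t * cos t).
Proof. unfold chord_sq; auto_derive; [trivial|ring]. Qed.

Lemma is_derive_chord_pow (n : nat) (t : R) : is_derive (chord_pow n) t (chord_pow' n t).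
Proof.
  unfold chord_pow, chord_pow'.
  replace (INR (S n) * chord_sq t ^ n * (8 * sin t * cos t))
    with (INR (S n) * (8 * sin t * cos t) * chord_sq t ^ pred (S n)) by (simpl pred; ring).
  apply is_derive_pow, is_derive_chord_sq.
Qed.

Lemma is_derive_chord_pow' (n : nat) (t : R) : is_derive (chord_pow' n) t (chord_pow'' n t).
Proof.
  unfold chord_pow', chord_pow''.
  assert (D1 : is_derive (fun t => INR (S n) * chord_sq t ^ n) t
    (INR (S n) * (INR n * (8 * sin t * cos t) * chord_sq t ^ pred n))).
  { apply is_derive_scal, is_derive_pow, is_derive_chord_sq. }
  assert (D2 : is_derive (fun t => 8 * sin t * cos t) t (8 * (cos t) ^ 2 - 8 * sin t ^ 2)).
  { auto_derive; [trivial|ring]. }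
  generalize (is_derive_mult _ _ t _ _ D1 D2 Rmult_comm).
  match goal with |- is_derive _ _ ?A -> is_derive _ _ ?B => replace A with B; auto end.
  unfold plus, mult; simpl.
  assert (C2 : cos t ^ 2 = 1 - sin t ^ 2)
    by (generalize (sin2_cos2 t); unfold Rsqr; simpl; lra).
  fold (INR (S n)).
  assert (Hp : INR n * chord_sq t ^ pred n * chord_sq t = INR n * chord_sq t ^ n)
    by (destruct n; simpl; ring).
  change (match n with O => 1 | S _ => INR n + 1 end) with (INR (S n)).
  transitivity (INR (S n) * (16 * cos t ^ 2 * (INR n * chord_sq t ^ pred n * chord_sq t)
     + chord_sq t ^ n * (8 * cos t ^ 2 - 8 * sin t ^ 2))).
  - rewrite Hp, C2, S_INR; unfold chord_sq; ring.
  - unfold chord_sq; ring.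
Qed.

Definition arcsin_coef (n : nat) : R := 1 / (INR (S n) ^ 2 * central_binom (S n)).

Definition arcsin2_sum (N : nat) (t : R) : R := sum_n (fun n => arcsin_coef n * chord_pow n t) N.
Definition arcsin2_sum' (N : nat) (t : R) : R := sum_n (fun n => arcsin_coef n * chord_pow' n t) N.
Definition arcsin4_sum' (N : nat) (t : R) : R :=
  sum_n (fun n => S2 n * arcsin_coef n * chord_pow' n t) N.

(** The factor [8 k (2k-1)] produced by differentiating twice is the one in the recurrence of the
    central binomial coefficients, so the second derivatives telescope. *)
Lemma arcsin_coef_chord_pow'' (n : nat) (t : R) :
  arcsin_coef n * chord_pow'' n t
  = 4 * chord_sq t ^ n / central_binom n - 4 * chord_sq t ^ S n / central_binom (S n).
Proof.
  unfold arcsin_coef, chord_pow''; rewrite central_binom_S, <- (tech_pow_Rmult (chord_sq t) n).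
  generalize (INR_S_pos n) (central_binom_ge n) (pos_INR n); rewrite S_INR; intros.
  field; repeat split; lra.
Qed.

Lemma arcsin2_sum''_eq (N : nat) (t : R) :
  sum_n (fun n => arcsin_coef n * chord_pow'' n t) N
  = 4 - 4 * chord_sq t ^ S N / central_binom (S N) :> R.
Proof.
  induction N as [|N IH]; [rewrite sum_n_0|rewrite sum_n_S, IH];
    rewrite arcsin_coef_chord_pow''; [rewrite central_binom_0; simpl; field|ring].
  rewrite central_binom_S, central_binom_0; simpl; lra.
Qed.

(** Summation by parts: the increments of [S2] turn the telescoping terms back into the series
    for the square of the arcsine. *)
Lemma arcsin4_sum''_eq (N : nat) (t : R) :
  sum_n (fun n => S2 n * arcsin_coef n * chord_pow'' n t) N
  = 4 * arcsin2_sum N t - 4 * S2 (S N) * chord_sq t ^ S N / central_binom (S N) :> R.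
Proof.
  unfold arcsin2_sum; induction N as [|N IH]; [rewrite !sum_n_0|rewrite !sum_n_S, IH];
    rewrite (Rmult_assoc (S2 _)), arcsin_coef_chord_pow''; unfold arcsin_coef, chord_pow.
  - generalize (central_binom_ge 1); rewrite S2_S, S2_0, central_binom_0; simpl; intros; field; lra.
  - rewrite !(S2_S (S N)).
    generalize (central_binom_ge (S N)) (central_binom_ge (S (S N)))
      (INR_S_pos N) (INR_S_pos (S N)) (INR_S_pos (S (S N))); intros.
    field; repeat split; lra.
Qed.

Lemma chord_sq_bounds (t : R) : 0 <= t <= PI / 6 -> 0 <= chord_sq t <= 1.
Proof.
  intros Ht; unfold chord_sq.
  assert (HP := PI_RGT_0).
  assert (0 <= sin t) by (apply sin_ge_0; lra).
  assert (sin t <= / 2).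
  { replace (/ 2) with (sin (PI / 6)) by (rewrite sin_PI6; lra). apply sin_incr_1; lra. }
  nra.
Qed.

Lemma chord_remainder (N : nat) (t : R) :
  0 <= t <= PI / 6 ->
  0 <= chord_sq t ^ S N / central_binom (S N) <= / INR (S N).
Proof.
  intros Ht; generalize (chord_sq_bounds t Ht); intros [H0 H1].
  assert (Hc := central_binom_ge (S N)).
  assert (HN := INR_S_pos N); rewrite (S_INR (S N)) in Hc.
  assert (Hx : 0 <= chord_sq t ^ S N <= 1).
  { split; [apply pow_le; auto|]. rewrite <- (pow1 (S N)); apply pow_incr; auto. }
  split; [apply Rmult_le_pos; [lra|left; apply Rinv_0_lt_compat; lra]|].
  unfold Rdiv; rewrite <- (Rmult_1_l (/ INR (S N))).
  apply Rmult_le_compat; try lra; [left; apply Rinv_0_lt_compat; lra|].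
  apply Rinv_le_contravar; lra.
Qed.

Lemma chord_sq_0 : chord_sq 0 = 0.
Proof. unfold chord_sq; rewrite sin_0; ring. Qed.

Lemma weighted_chord_sums_0 (c : nat -> R) (N : nat) :
  sum_n (fun n => c n * chord_pow n 0) N = 0 :> R
  /\ sum_n (fun n => c n * chord_pow' n 0) N = 0 :> R.
Proof.
  assert (E : forall n, c n * chord_pow n 0 = 0 /\ c n * chord_pow' n 0 = 0).
  { intros n; unfold chord_pow, chord_pow'; rewrite chord_sq_0, sin_0; split; simpl; ring. }
  induction N as [|N [IH1 IH2]]; [rewrite !sum_n_0; apply E|].
  rewrite !sum_n_S, IH1, IH2, (proj1 (E (S N))), (proj2 (E (S N))); lra.
Qed.

Lemma PI6_le_1 : PI / 6 <= 1.
Proof. generalize PI_4; lra. Qed.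

Lemma is_derive_arcsin2_sum (N : nat) (t : R) : is_derive (arcsin2_sum N) t (arcsin2_sum' N t).
Proof.
  apply (is_derive_sum (fun n x => arcsin_coef n * chord_pow n x)
                       (fun n x => arcsin_coef n * chord_pow' n x)).
  intros n; apply is_derive_scal, is_derive_chord_pow.
Qed.

Lemma is_derive_arcsin2_sum' (N : nat) (t : R) :
  is_derive (arcsin2_sum' N) t (4 - 4 * chord_sq t ^ S N / central_binom (S N)).
Proof.
  rewrite <- arcsin2_sum''_eq.
  apply (is_derive_sum (fun n x => arcsin_coef n * chord_pow' n x)
                       (fun n x => arcsin_coef n * chord_pow'' n x)).
  intros n; apply is_derive_scal, is_derive_chord_pow'.
Qed.

Lemma is_derive_arcsin4_sum' (N : nat) (t : R) :
  is_derive (arcsin4_sum' N) t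
    (4 * arcsin2_sum N t - 4 * S2 (S N) * chord_sq t ^ S N / central_binom (S N)).
Proof.
  rewrite <- arcsin4_sum''_eq.
  apply (is_derive_sum (fun n x => S2 n * arcsin_coef n * chord_pow' n x)
                       (fun n x => S2 n * arcsin_coef n * chord_pow'' n x)).
  intros n; apply is_derive_scal, is_derive_chord_pow'.
Qed.

(** The derivative, with an error term, of one of the two limiting identities; these are
    sum x^k/(k^2 C(2k,k)) = 2 t^2 and sum S2(k-1) x^k/(k^2 C(2k,k)) = (2/3) t^4 with
    x = [chord_sq t]. The errors keep a factor [t], which later absorbs the powers of the logarithm
    at 0. *)
Lemma arcsin2_sum'_approx (N : nat) (t : R) :
  0 <= t <= PI / 6 -> Rabs (arcsin2_sum' N t - 4 * t) <= 4 / INR (S N) * t.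
Proof.
  intros Ht.
  replace (arcsin2_sum' N t - 4 * t) with ((arcsin2_sum' N t - 4 * t) - (arcsin2_sum' N 0 - 4 * 0))
    by (unfold arcsin2_sum' at 2; rewrite (proj2 (weighted_chord_sums_0 _ _)); ring).
  replace (4 / INR (S N) * t) with (4 / INR (S N) * t - 4 / INR (S N) * 0) by ring.
  apply (increment_le_of_derive_le (fun t => arcsin2_sum' N t - 4 * t) (fun t => 4 / INR (S N) * t)
    (fun t => (4 - 4 * chord_sq t ^ S N / central_binom (S N)) - 4) (fun _ => 4 / INR (S N)));
    [lra| | |].
  - intros x _; apply (is_derive_minus (arcsin2_sum' N)); [apply is_derive_arcsin2_sum'|apply is_derive_linear].
  - intros x _; apply is_derive_linear.
  - intros x Hx.
    assert (Hr := chord_remainder N x); unfold Rdiv in *.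
    apply Rabs_le; split; lra.
Qed.

Lemma arcsin2_sum_approx (N : nat) (t : R) :
  0 <= t <= PI / 6 -> Rabs (arcsin2_sum N t - 2 * t ^ 2) <= 2 / INR (S N) * t ^ 2.
Proof.
  intros Ht.
  replace (arcsin2_sum N t - 2 * t ^ 2)
    with ((arcsin2_sum N t - 2 * t ^ 2) - (arcsin2_sum N 0 - 2 * 0 ^ 2))
    by (unfold arcsin2_sum at 2; rewrite (proj1 (weighted_chord_sums_0 _ _)); ring).
  replace (2 / INR (S N) * t ^ 2) with (2 / INR (S N) * t ^ 2 - 2 / INR (S N) * 0 ^ 2) by ring.
  apply (increment_le_of_derive_le (fun t => arcsin2_sum N t - 2 * t ^ 2)
    (fun t => 2 / INR (S N) * t ^ 2)
    (fun t => arcsin2_sum' N t - 4 * t) (fun t => 4 / INR (S N) * t)); [lra| | |].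
  - intros x _; apply (is_derive_minus (arcsin2_sum N)); [apply is_derive_arcsin2_sum|].
    auto_derive; [trivial|ring].
  - intros x _; generalize (INR_S_pos N); generalize (INR (S N)); intros k Hk.
    auto_derive; [trivial|field; lra].
  - intros x Hx; apply arcsin2_sum'_approx; lra.
Qed.

Lemma arcsin4_sum'_approx (N : nat) (t : R) :
  0 <= t <= PI / 6 -> Rabs (arcsin4_sum' N t - 8 / 3 * t ^ 3) <= 16 / INR (S N) * t.
Proof.
  intros Ht.
  replace (arcsin4_sum' N t - 8 / 3 * t ^ 3)
    with ((arcsin4_sum' N t - 8 / 3 * t ^ 3) - (arcsin4_sum' N 0 - 8 / 3 * 0 ^ 3))
    by (unfold arcsin4_sum' at 2;
        rewrite (proj2 (weighted_chord_sums_0 (fun n => S2 n * arcsin_coef n) _)); ring).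
  replace (16 / INR (S N) * t) with (16 / INR (S N) * t - 16 / INR (S N) * 0) by ring.
  apply (increment_le_of_derive_le (fun t => arcsin4_sum' N t - 8 / 3 * t ^ 3)
    (fun t => 16 / INR (S N) * t)
    (fun t => (4 * arcsin2_sum N t - 4 * S2 (S N) * chord_sq t ^ S N / central_binom (S N))
              - 8 * t ^ 2) (fun _ => 16 / INR (S N))); [lra| | |].
  - intros x _; apply (is_derive_minus (arcsin4_sum' N)); [apply is_derive_arcsin4_sum'|].
    auto_derive; [trivial|field].
  - intros x _; apply is_derive_linear.
  - intros x Hx.
    assert (Hx' : 0 <= x <= PI / 6) by lra.
    assert (Hr := chord_remainder N x Hx').
    assert (Ha := arcsin2_sum_approx N x Hx').
    assert (HS := S2_bounds (S N)); assert (H1 := PI6_le_1).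
    assert (Hi : 0 < / INR (S N)) by apply Rinv_0_lt_compat, INR_S_pos.
    replace (4 * S2 (S N) * chord_sq x ^ S N / central_binom (S N))
      with (4 * (S2 (S N) * (chord_sq x ^ S N / central_binom (S N)))) by (unfold Rdiv; ring).
    assert (0 <= S2 (S N) * (chord_sq x ^ S N / central_binom (S N)) <= 2 * / INR (S N)) by nra.
    assert (x ^ 2 <= 1) by nra.
    assert (/ INR (S N) * x ^ 2 <= / INR (S N)) by nra.
    unfold Rdiv in Ha |- *; apply Rabs_le_between in Ha; apply Rabs_le; split; lra.
Qed.

(** * A complex logarithmic integral along an arc *)

(** Componentwise differentiation: in the end only the derivative of a real part is needed, but
    the product rule that makes [log_poly] work is a complex identity. *)
Definition is_cderive (f : R -> C) (t : R) (d : C) : Prop :=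
  is_derive (fun x => Re (f x)) t (Re d) /\ is_derive (fun x => Im (f x)) t (Im d).

Lemma is_cderive_eq (f : R -> C) (t : R) (d d' : C) :
  is_cderive f t d -> d = d' -> is_cderive f t d'.
Proof. now intros H <-. Qed.

Lemma is_cderive_plus (f g : R -> C) (t : R) (df dg : C) :
  is_cderive f t df -> is_cderive g t dg ->
  is_cderive (fun x => f x + g x)%C t (df + dg)%C.
Proof.
  intros [F1 F2] [G1 G2]; split.
  - apply (is_derive_plus (fun x => Re (f x)) (fun x => Re (g x)) t _ _ F1 G1).
  - apply (is_derive_plus (fun x => Im (f x)) (fun x => Im (g x)) t _ _ F2 G2).
Qed.

Lemma is_cderive_mult (f g : R -> C) (t : R) (df dg : C) :
  is_cderive f t df -> is_cderive g t dg ->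
  is_cderive (fun x => f x * g x)%C t (df * g t + f t * dg)%C.
Proof.
  intros [F1 F2] [G1 G2].
  assert (M11 := is_derive_mult _ _ t _ _ F1 G1 Rmult_comm).
  assert (M12 := is_derive_mult _ _ t _ _ F1 G2 Rmult_comm).
  assert (M21 := is_derive_mult _ _ t _ _ F2 G1 Rmult_comm).
  assert (M22 := is_derive_mult _ _ t _ _ F2 G2 Rmult_comm).
  split.
  - generalize (is_derive_minus _ _ t _ _ M11 M22).
    match goal with |- is_derive _ _ ?A -> is_derive _ _ ?B => replace B with A; auto end.
    unfold minus, plus, opp, mult, Re, Im; simpl; ring.
  - generalize (is_derive_plus _ _ t _ _ M12 M21).
    match goal with |- is_derive _ _ ?A -> is_derive _ _ ?B => replace B with A; auto end.
    unfold minus, plus, opp, mult, Re, Im; simpl; ring.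
Qed.

Lemma is_cderive_const (c : C) (t : R) : is_cderive (fun _ => c) t 0%C.
Proof. split; exact (is_derive_const _ t). Qed.

Lemma is_cderive_scal (c : C) (f : R -> C) (t : R) (d : C) :
  is_cderive f t d -> is_cderive (fun x => c * f x)%C t (c * d)%C.
Proof.
  intros H.
  apply (is_cderive_eq _ _ _ _ (is_cderive_mult _ _ t _ _ (is_cderive_const c t) H)); ring.
Qed.

Lemma is_cderive_pow (f : R -> C) (t : R) (d : C) (n : nat) :
  is_cderive f t d ->
  is_cderive (fun x => f x ^ S n)%C t (INR (S n) * f t ^ n * d)%C.
Proof.
  intros H; induction n as [|n IH].
  - apply (is_cderive_eq _ _ _ _ (is_cderive_mult _ _ t _ _ H (is_cderive_const 1%C t))).
    simpl; ring.
  - apply (is_cderive_eq _ _ _ _ (is_cderive_mult _ _ t _ _ H IH)).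
    rewrite (S_INR (S n)), RtoC_plus, !Cpow_S; ring.
Qed.

Definition log_chord (t : R) : R := ln (2 * sin t).

(** A logarithm of [2 sin t * exp (i t) = Ci * arc t] along the path, written out to avoid a choice
    of branch. *)
Definition arc_log (t : R) : C := (log_chord t, t).

Definition arc_log' (t : R) : C := (cos t / sin t, 1)%R.

(** [1 - exp (2 i t)], the path along which the integral is taken; its modulus is [2 sin t]. *)
Definition arc (t : R) : C := (1 - cos (2 * t), - sin (2 * t)).

(** The polynomial solution [Q] of [k Q + Q' = z ^ 5]. Hence [u ^ k Q(log u)] is a primitive of
    [u ^ (k-1) (log u) ^ 5], and the sum over [k] of these primitives is a combination of
    polylogarithms of orders 1 to 6. *)
Definition log_poly (k : R) (z : C) : C :=
  ((/ k) * z ^ 5 + ((- 5 / k ^ 2) * z ^ 4 + ((20 / k ^ 3) * z ^ 3 + ((- 60 / k ^ 4) * z ^ 2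
   + ((120 / k ^ 5) * z + - 120 / k ^ 6)))))%C.

Lemma is_derive_log_chord (t : R) : 0 < sin t -> is_derive log_chord t (cos t / sin t).
Proof. intros Hs; unfold log_chord; auto_derive; [lra|field; lra]. Qed.

Lemma is_cderive_arc_log (t : R) : 0 < sin t -> is_cderive arc_log t (arc_log' t).
Proof.
  intros Hs; split; simpl; [now apply is_derive_log_chord|].
  apply (is_derive_id t).
Qed.

Lemma is_cderive_arc (t : R) : is_cderive arc t (- 2 * Ci * (1 - arc t))%C.
Proof. split; unfold arc; simpl; auto_derive; trivial; ring. Qed.

Lemma arc_mult_arc_log' (t : R) :
  0 < sin t -> (arc t * arc_log' t = - 2 * Ci * (1 - arc t))%C.
Proof.
  intros Hs; unfold arc, arc_log'; rewrite sin_2a, cos_2a_sin.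
  assert (H2 : cos t * cos t = 1 - sin t * sin t)
    by (generalize (sin2_cos2 t); unfold Rsqr; lra).
  apply injective_projections; simpl.
  - field; lra.
  - field_simplify; [|lra]. replace (cos t ^ 2) with (1 - sin t * sin t) by (simpl; lra). field; lra.
Qed.

Lemma is_cderive_log_poly (k : R) (f : R -> C) (t : R) (d : C) :
  k <> 0 -> is_cderive f t d ->
  is_cderive (fun x => log_poly k (f x)) t ((f t ^ 5 - k * log_poly k (f t)) * d)%C.
Proof.
  intros Hk H.
  assert (Hk' : RtoC k <> 0%C) by (intros E; apply Hk; now injection E).
  eapply is_cderive_eq.
  { unfold log_poly.
    do 5 (apply is_cderive_plus;
          [apply is_cderive_scal; first [exact H | apply is_cderive_pow; exact H]|]).
    apply is_cderive_const. }
  simpl INR; unfold log_poly; rewrite ?RtoC_plus; simpl; field; auto.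
Qed.

Lemma is_cderive_arc_term (n : nat) (t : R) :
  0 < sin t ->
  is_cderive (fun x => arc x ^ S n * log_poly (INR (S n)) (arc_log x))%C t
    (- 2 * Ci * (1 - arc t) * arc t ^ n * arc_log t ^ 5)%C.
Proof.
  intros Hs.
  assert (Hk : INR (S n) <> 0) by apply Rgt_not_eq, INR_S_pos.
  eapply is_cderive_eq.
  { apply is_cderive_mult; [apply is_cderive_pow, is_cderive_arc|].
    apply is_cderive_log_poly; [exact Hk|apply is_cderive_arc_log; exact Hs]. }
  rewrite <- (arc_mult_arc_log' t Hs), Cpow_S; ring.
Qed.

Lemma Re_m2i_mult (u v w : C) :
  Re (- 2 * Ci * (1 - u) * v * w) = 2 * Im (w * v) - 2 * Im (w * (u * v)).
Proof.
  destruct u as [u1 u2], v as [v1 v2], w as [w1 w2]; unfold Re, Im; simpl; ring.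
Qed.

Definition arc_sum (N : nat) (t : R) : R :=
  sum_n (fun n => Re (arc t ^ S n * log_poly (INR (S n)) (arc_log t))) N.

(** The derivative of [arc] carries the factor [1 - arc t], which sums the geometric series: what
    remains is the integrand [2 * Im (arc_log t ^ 5)] and a remainder in [arc t ^ S N]. *)
Lemma is_derive_arc_sum (N : nat) (t : R) :
  0 < sin t ->
  is_derive (arc_sum N) t (2 * Im (arc_log t ^ 5) - 2 * Im (arc_log t ^ 5 * arc t ^ S N)).
Proof.
  intros Hs.
  assert (E : 2 * Im (arc_log t ^ 5) - 2 * Im (arc_log t ^ 5 * arc t ^ S N)
    = sum_n (fun n => Re (- 2 * Ci * (1 - arc t) * arc t ^ n * arc_log t ^ 5)%C) N).
  { assert (T : forall n, Re (- 2 * Ci * (1 - arc t) * arc t ^ n * arc_log t ^ 5)%C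
      = 2 * Im (arc_log t ^ 5 * arc t ^ n) - 2 * Im (arc_log t ^ 5 * arc t ^ S n)).
    { intros n; rewrite Cpow_S; apply Re_m2i_mult. }
    induction N as [|N IH]; [rewrite sum_n_0|rewrite sum_n_S, <- IH]; rewrite T.
    - replace (arc_log t ^ 5 * arc t ^ 0)%C with (arc_log t ^ 5)%C 
        by (change (arc t ^ 0)%C with (RtoC 1); ring).
      reflexivity.
    - ring. }
  rewrite E.
  apply (is_derive_sum_at (fun n x => Re (arc x ^ S n * log_poly (INR (S n)) (arc_log x)))
    (fun n => Re (- 2 * Ci * (1 - arc t) * arc t ^ n * arc_log t ^ 5)%C)).
  intros n; apply (is_cderive_arc_term n t Hs).
Qed.

Lemma Im_arc_log_pow5 (t : R) :
  Im (arc_log t ^ 5) = 5 * log_chord t ^ 4 * t - 10 * log_chord t ^ 2 * t ^ 3 + t ^ 5.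
Proof. unfold arc_log, Im; simpl; ring. Qed.

Lemma Cmod_arc (t : R) : 0 < sin t -> Cmod (arc t) = 2 * sin t.
Proof.
  intros Hs; unfold Cmod, arc; rewrite sin_2a, cos_2a_sin; simpl fst; simpl snd.
  replace ((1 - (1 - 2 * sin t * sin t)) ^ 2 + (- (2 * sin t * cos t)) ^ 2)
    with (Rsqr (2 * sin t) * (Rsqr (sin t) + Rsqr (cos t))) by (unfold Rsqr; ring).
  rewrite sin2_cos2, Rmult_1_r; apply sqrt_Rsqr; lra.
Qed.

Lemma Im_le_Cmod (z : C) : Rabs (Im z) <= Cmod z.
Proof. eapply Rle_trans; [apply Rmax_r|apply Rmax_Cmod]. Qed.

(** * The end point of the arc *)

Lemma sin_PI6_half : 2 * sin (PI / 6) = 1.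
Proof. rewrite sin_PI6; lra. Qed.

Lemma log_chord_PI6 : log_chord (PI / 6) = 0.
Proof. unfold log_chord; rewrite sin_PI6_half; apply ln_1. Qed.

(** At [PI/6] the path reaches [exp (- i PI/3)], on the unit circle, where the powers become the
    trigonometric terms of the Fourier series. *)
Lemma arc_pow_PI6 (n : nat) :
  (arc (PI / 6) ^ n)%C = (cos (INR n * (PI / 3)), - sin (INR n * (PI / 3)))%R.
Proof.
  induction n as [|n IH].
  - simpl; rewrite Rmult_0_l, cos_0, sin_0, Ropp_0; reflexivity.
  - rewrite Cpow_S, IH, S_INR, Rmult_plus_distr_r, Rmult_1_l, cos_plus, sin_plus.
    unfold arc; replace (2 * (PI / 6)) with (PI / 3) by field.
    rewrite cos_PI3; apply injective_projections; simpl; field.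
Qed.

Lemma log_poly_imaginary (k a : R) :
  k <> 0 ->
  log_poly k (0, a)%R = (- 5 * a ^ 4 / k ^ 2 + 60 * a ^ 2 / k ^ 4 - 120 / k ^ 6,
                        a ^ 5 / k - 20 * a ^ 3 / k ^ 3 + 120 * a / k ^ 5)%R.
Proof.
  intros Hk; assert (Hk' : RtoC k <> 0%C) by (intros E; apply Hk; now injection E).
  unfold log_poly.
  rewrite <- !RtoC_pow, <- !RtoC_inv, <- !RtoC_div
    by (try apply pow_nonzero; auto).
  apply injective_projections; simpl; field; auto.
Qed.

(** The logarithm is purely imaginary at the end point, so the real part pairs odd orders with sines
    and even orders with cosines: exactly the sums that are Bernoulli polynomials. *)
Lemma arc_sum_PI6 (N : nat) :
  arc_sum N (PI / 6)
  = (PI / 6) ^ 5 * sin_sum 1 N (PI / 3) - 5 * (PI / 6) ^ 4 * cos_sum 2 N (PI / 3)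
    - 20 * (PI / 6) ^ 3 * sin_sum 3 N (PI / 3) + 60 * (PI / 6) ^ 2 * cos_sum 4 N (PI / 3)
    + 120 * (PI / 6) * sin_sum 5 N (PI / 3) - 120 * cos_sum 6 N (PI / 3).
Proof.
  assert (T : forall n, let k := INR (S n) in
    Re (arc (PI / 6) ^ S n * log_poly k (arc_log (PI / 6)))
    = (PI / 6) ^ 5 * (sin (k * (PI / 3)) / k ^ 1) - 5 * (PI / 6) ^ 4 * (cos (k * (PI / 3)) / k ^ 2)
    - 20 * (PI / 6) ^ 3 * (sin (k * (PI / 3)) / k ^ 3)
    + 60 * (PI / 6) ^ 2 * (cos (k * (PI / 3)) / k ^ 4)
    + 120 * (PI / 6) * (sin (k * (PI / 3)) / k ^ 5) - 120 * (cos (k * (PI / 3)) / k ^ 6)).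
  { intros n k; unfold k; rewrite arc_pow_PI6; unfold arc_log; rewrite log_chord_PI6.
    generalize (INR_S_pos n); generalize (INR (S n)); clear; intros k Hk.
    rewrite log_poly_imaginary by lra; unfold Re; simpl fst; simpl snd; field; lra. }
  unfold arc_sum, sin_sum, cos_sum.
  induction N as [|N IH]; [rewrite !sum_n_0|rewrite !sum_n_S, IH]; rewrite T; ring.
Qed.

Lemma arc_sum_limit :
  is_lim_seq (fun N => arc_sum N (PI / 6))
    (15 / 4 * (8 / 90 * (PI / 6) ^ 6 + 313 * PI ^ 6 / 612360)).
Proof.
  assert (HP := PI_RGT_0).
  assert (Ht : 0 < PI / 3 < PI) by lra.
  destruct bernoulli_fourier as (H2 & H3 & H4 & H5 & H6).
  apply uniform_limit_at with (t := PI / 3) in H2; auto.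
  apply uniform_limit_at with (t := PI / 3) in H3; auto.
  apply uniform_limit_at with (t := PI / 3) in H4; auto.
  apply uniform_limit_at with (t := PI / 3) in H5; auto.
  apply uniform_limit_at with (t := PI / 3) in H6; auto.
  assert (H1 : is_lim_seq (fun N => sin_sum 1 N (PI / 3)) ((PI - PI / 3) / 2)).
  { destruct (sawtooth_rate (PI / 3)) as (K & _ & B); [lra|].
    apply (is_lim_seq_of_abs_le _ (fun N => K / INR (S N))); [|apply is_lim_seq_const_div_S].
    intros N; apply B; lra. }
  apply (is_lim_seq_ext _ _ _ (fun N => eq_sym (arc_sum_PI6 N))).
  match goal with |- is_lim_seq _ (Finite ?v) => assert (E : v =
    (PI / 6) ^ 5 * ((PI - PI / 3) / 2)
    - 5 * (PI / 6) ^ 4 * ((PI / 3) ^ 2 / 4 - PI * (PI / 3) / 2 + PI ^ 2 / 6)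
    - 20 * (PI / 6) ^ 3 * ((PI / 3) ^ 3 / 12 - PI * (PI / 3) ^ 2 / 4 + PI ^ 2 * (PI / 3) / 6)
    + 60 * (PI / 6) ^ 2 * (- (PI / 3) ^ 4 / 48 + PI * (PI / 3) ^ 3 / 12
                           - PI ^ 2 * (PI / 3) ^ 2 / 12 + PI ^ 4 / 90)
    + 120 * (PI / 6) * (- (PI / 3) ^ 5 / 240 + PI * (PI / 3) ^ 4 / 48
                        - PI ^ 2 * (PI / 3) ^ 3 / 36 + PI ^ 4 * (PI / 3) / 90)
    - 120 * ((PI / 3) ^ 6 / 1440 - PI * (PI / 3) ^ 5 / 240 + PI ^ 2 * (PI / 3) ^ 4 / 144
             - PI ^ 4 * (PI / 3) ^ 2 / 180 + PI ^ 6 / 945)) by field end.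
  rewrite E; clear E.
  apply is_lim_seq_minus'; [|apply (is_lim_seq_scal_l _ 120 (Finite _) H6)].
  apply is_lim_seq_plus'; [|apply (is_lim_seq_scal_l _ _ (Finite _) H5)].
  apply is_lim_seq_plus'; [|apply (is_lim_seq_scal_l _ _ (Finite _) H4)].
  apply is_lim_seq_minus'; [|apply (is_lim_seq_scal_l _ _ (Finite _) H3)].
  apply is_lim_seq_minus'; [|apply (is_lim_seq_scal_l _ _ (Finite _) H2)].
  apply (is_lim_seq_scal_l _ _ (Finite _) H1).
Qed.

(** * The auxiliary function *)

(** [k^2 * log_weight4 k] is a truncated exponential series in [- 2 k * log_chord]; when its
    product with [chord_pow] is differentiated, only the last term times the derivative of
    [chord_pow] survives. This is repeated integration by parts for the factor [1/k^2] in the series, and [log_weight6] is the same for [1/k^4]. *)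
Definition log_weight4 (k t : R) : R :=
  1 / k ^ 2 - 2 * log_chord t / k + 2 * log_chord t ^ 2.

Definition log_weight6 (k t : R) : R :=
  1 / k ^ 4 - 2 * log_chord t / k ^ 3 + 2 * log_chord t ^ 2 / k ^ 2
  - 4 / 3 * log_chord t ^ 3 / k + 2 / 3 * log_chord t ^ 4.

(** At [PI/6] the logarithm vanishes and the chord is 1, so this is a partial sum of the series of
    the theorem. *)
Definition series_part (N : nat) (t : R) : R :=
  sum_n (fun n => S2 n * arcsin_coef n * (chord_pow n t * log_weight4 (INR (S n)) t)
                  - arcsin_coef n * (chord_pow n t * log_weight6 (INR (S n)) t)) N.

Lemma chord_pow'_eq (n : nat) (t : R) :
  0 < sin t -> chord_pow' n t = 2 * INR (S n) * chord_pow n t * (cos t / sin t).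
Proof.
  intros Hs; unfold chord_pow', chord_pow; rewrite <- tech_pow_Rmult.
  replace (8 * sin t * cos t) with (2 * chord_sq t * (cos t / sin t))
    by (unfold chord_sq; field; lra).
  ring.
Qed.

Lemma is_derive_weighted4 (n : nat) (t : R) :
  0 < sin t ->
  is_derive (fun x => chord_pow n x * log_weight4 (INR (S n)) x) t
    (2 * log_chord t ^ 2 * chord_pow' n t).
Proof.
  intros Hs; assert (Hk := INR_S_pos n).
  assert (DL := is_derive_log_chord t Hs).
  assert (DW : is_derive (log_weight4 (INR (S n))) t
    (cos t / sin t * (- 2 / INR (S n) + 4 * log_chord t))).
  { apply (is_derive_comp (fun l => 1 / INR (S n) ^ 2 - 2 * l / INR (S n) + 2 * l ^ 2)
             log_chord t _ _); [|exact DL].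
    generalize dependent (INR (S n)); intros k Hk; auto_derive; [trivial|field; lra]. }
  generalize (is_derive_mult _ _ t _ _ (is_derive_chord_pow n t) DW Rmult_comm).
  match goal with |- is_derive _ _ ?A -> is_derive _ _ ?B => replace B with A; auto end.
  rewrite (chord_pow'_eq n t Hs).
  unfold plus, mult; cbn -[INR pow chord_pow log_weight4].
  unfold log_weight4; field; lra.
Qed.

Lemma is_derive_weighted6 (n : nat) (t : R) :
  0 < sin t ->
  is_derive (fun x => chord_pow n x * log_weight6 (INR (S n)) x) t
    (2 / 3 * log_chord t ^ 4 * chord_pow' n t).
Proof.
  intros Hs; assert (Hk := INR_S_pos n).
  assert (DL := is_derive_log_chord t Hs).
  assert (DW : is_derive (log_weight6 (INR (S n))) t
    (cos t / sin t * (- 2 / INR (S n) ^ 3 + 4 * log_chord t / INR (S n) ^ 2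
                      - 4 * log_chord t ^ 2 / INR (S n) + 8 / 3 * log_chord t ^ 3))).
  { apply (is_derive_comp (fun l => 1 / INR (S n) ^ 4 - 2 * l / INR (S n) ^ 3
             + 2 * l ^ 2 / INR (S n) ^ 2 - 4 / 3 * l ^ 3 / INR (S n) + 2 / 3 * l ^ 4)
             log_chord t _ _); [|exact DL].
    generalize dependent (INR (S n)); intros k Hk; auto_derive; [trivial|field; lra]. }
  generalize (is_derive_mult _ _ t _ _ (is_derive_chord_pow n t) DW Rmult_comm).
  match goal with |- is_derive _ _ ?A -> is_derive _ _ ?B => replace B with A; auto end.
  rewrite (chord_pow'_eq n t Hs).
  unfold plus, mult; cbn -[INR pow chord_pow log_weight6].
  unfold log_weight6; field; lra.
Qed.

Lemma is_derive_series_part (N : nat) (t : R) :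
  0 < sin t ->
  is_derive (series_part N) t
    (2 * log_chord t ^ 2 * arcsin4_sum' N t - 2 / 3 * log_chord t ^ 4 * arcsin2_sum' N t).
Proof.
  intros Hs.
  set (d := fun n => S2 n * arcsin_coef n * (2 * log_chord t ^ 2 * chord_pow' n t)
                     - arcsin_coef n * (2 / 3 * log_chord t ^ 4 * chord_pow' n t)).
  assert (E : 2 * log_chord t ^ 2 * arcsin4_sum' N t - 2 / 3 * log_chord t ^ 4 * arcsin2_sum' N t
              = sum_n d N).
  { unfold arcsin4_sum', arcsin2_sum'; induction N as [|N IH];
      [rewrite !sum_n_0|rewrite !sum_n_S, <- IH]; unfold d; ring. }
  rewrite E.
  apply (is_derive_sum_at (fun n x => S2 n * arcsin_coef n * (chord_pow n x * log_weight4 (INR (S n)) x)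
                                      - arcsin_coef n * (chord_pow n x * log_weight6 (INR (S n)) x))).
  intros n; unfold d.
  apply (is_derive_minus
    (fun x => S2 n * arcsin_coef n * (chord_pow n x * log_weight4 (INR (S n)) x))
    (fun x => arcsin_coef n * (chord_pow n x * log_weight6 (INR (S n)) x)));
    apply is_derive_scal; [apply is_derive_weighted4|apply is_derive_weighted6]; exact Hs.
Qed.

(** The combination whose derivative tends to 0. The coefficients come from
    [Im (L + i t)^5 = 5 L^4 t - 10 L^2 t^3 + t^5], which turns [(16/3) t^3 L^2 - (8/3) t L^4] into
    [- (8/15) (Im (L + i t)^5 - t^5)]; [arc_sum] carries half of 8/15 because its derivative
    approximates twice the imaginary part. *)
Definition potential (N : nat) (t : R) : R :=
  series_part N t + (4 / 15 * arc_sum N t - 8 / 90 * t ^ 6).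

Lemma is_derive_potential (N : nat) (t : R) :
  0 < sin t ->
  is_derive (potential N) t
    (2 * log_chord t ^ 2 * (arcsin4_sum' N t - 8 / 3 * t ^ 3)
     - 2 / 3 * log_chord t ^ 4 * (arcsin2_sum' N t - 4 * t)
     - 8 / 15 * Im (arc_log t ^ 5 * arc t ^ S N)).
Proof.
  intros Hs.
  assert (D1 := is_derive_series_part N t Hs).
  assert (D2 := is_derive_scal _ _ (4 / 15) _ (is_derive_arc_sum N t Hs)).
  assert (D3 : is_derive (fun x => 8 / 90 * x ^ 6) t (8 / 15 * t ^ 5))
    by (auto_derive; [trivial|field]).
  assert (D := is_derive_plus _ _ _ _ _ D1 (is_derive_minus _ _ _ _ _ D2 D3)).
  rewrite Im_arc_log_pow5 in D.
  match type of D with is_derive _ _ ?A =>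
    match goal with |- is_derive _ _ ?B => replace B with A end end; [exact D|].
  unfold plus, minus, opp; cbn -[pow Im arcsin4_sum' arcsin2_sum' Cpow Cmult]; unfold plus; simpl plus.
  field.
Qed.

(** * Estimates along the arc *)

Lemma arc_range (t : R) :
  0 < t <= PI / 6 -> 0 < sin t /\ t <= 2 * sin t <= 1 /\ / 2 <= cos t.
Proof.
  intros Ht; assert (HP := PI_RGT_0).
  assert (Hc : forall x, 0 <= x <= PI / 6 -> / 2 <= cos x).
  { intros x Hx; replace (/ 2) with (cos (PI / 3)) by (rewrite cos_PI3; lra).
    apply cos_decr_1; lra. }
  split; [apply sin_gt_0; lra|split; [split|apply Hc; lra]].
  - assert (B : Rabs (t - 0) <= 2 * sin t - 2 * sin 0).
    { apply (increment_le_of_derive_le (fun x => x) (fun x => 2 * sin x)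
        (fun _ => 1) (fun x => 2 * cos x)); [lra| | |].
      - intros x _; apply (is_derive_id x).
      - intros x _; auto_derive; [trivial|ring].
      - intros x Hx; rewrite Rabs_R1; generalize (Hc x); lra. }
    rewrite sin_0 in B; generalize (Rle_abs (t - 0)); lra.
  - rewrite <- sin_PI6_half; apply Rmult_le_compat_l; [lra|].
    apply sin_incr_1; lra.
Qed.

(** The square root of the chord [2 sin t], used as a gauge: it tends to 0 with [t] and, up
    to a constant, dominates [2 sin t * (1 + abs(log (2 sin t)))^5]. *)
Definition root_chord (t : R) : R := exp (log_chord t / 2).

Lemma root_chord_sq (t : R) : 0 < sin t -> root_chord t ^ 2 = 2 * sin t.
Proof.
  intros Hs; unfold root_chord; simpl; rewrite Rmult_1_r, <- exp_plus.
  replace (log_chord t / 2 + log_chord t / 2) with (log_chord t) by field.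
  unfold log_chord; apply exp_ln; lra.
Qed.

Lemma root_chord_bounds (t : R) : 0 < t <= PI / 6 -> 0 < root_chord t <= 1.
Proof.
  intros Ht; destruct (arc_range t Ht) as (Hs & H1 & _).
  assert (H2 := root_chord_sq t Hs).
  assert (H3 : 0 < root_chord t) by apply exp_pos.
  split; nra.
Qed.

(** With [2 sin t = exp (- y)], the bound [1 + y <= 10 exp (y/10)] raised to the fifth power costs
    only half of the exponent. *)
Lemma log_growth (t : R) :
  0 < t <= PI / 6 ->
  (1 + Rabs (log_chord t)) ^ 5 * (2 * sin t) <= 10 ^ 5 * root_chord t.
Proof.
  intros Ht; destruct (arc_range t Ht) as (Hs & H1 & _).
  assert (HL : log_chord t <= 0).
  { rewrite <- ln_1; unfold log_chord.
    destruct (Req_dec (2 * sin t) 1) as [->|Hne]; [lra|].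
    left; apply ln_increasing; lra. }
  rewrite Rabs_left1 by exact HL.
  set (y := - log_chord t).
  assert (E : (1 + y) ^ 5 <= 10 ^ 5 * exp (y / 2)).
  { replace (exp (y / 2)) with (exp (y / 10) ^ 5).
    2:{ simpl; rewrite Rmult_1_r, <- !exp_plus; f_equal; field. }
    rewrite <- Rpow_mult_distr; apply pow_incr.
    generalize (exp_ineq1_le (y / 10)); unfold y; lra. }
  rewrite <- (root_chord_sq t Hs).
  assert (E2 : exp (y / 2) * root_chord t = 1).
  { unfold root_chord, y; rewrite <- exp_plus.
    replace (- log_chord t / 2 + log_chord t / 2) with 0 by field; apply exp_0. }
  assert (H3 : 0 < root_chord t) by apply exp_pos.
  apply Rle_trans with (10 ^ 5 * exp (y / 2) * root_chord t ^ 2).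
  - apply Rmult_le_compat_r; [apply pow2_ge_0|exact E].
  - right; transitivity (10 ^ 5 * (exp (y / 2) * root_chord t) * root_chord t); [ring|].
    rewrite E2; ring.
Qed.

Lemma pow_log_le (l : R) (j : nat) : (j <= 5)%nat -> 0 <= l -> l ^ j <= (1 + l) ^ 5.
Proof.
  intros Hj Hl; apply Rle_trans with ((1 + l) ^ j); [apply pow_incr; lra|].
  apply Rle_pow; [lra|exact Hj].
Qed.

Lemma Cmod_arc_log (t : R) : 0 < t <= PI / 6 -> Cmod (arc_log t) <= 1 + Rabs (log_chord t).
Proof.
  intros Ht; assert (H1 := PI6_le_1).
  replace (arc_log t) with (RtoC (log_chord t) + RtoC t * Ci)%C
    by (apply injective_projections; simpl; ring).
  eapply Rle_trans; [apply Cmod_triangle|].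
  rewrite Cmod_mult, !Cmod_R, Cmod_Ci, (Rabs_pos_eq t); lra.
Qed.

(** The last term does not tend to 0 at [PI/6], where the chord is 1. The factor [2 * cos t >= 1] is
    inserted so that the bound is the derivative of a power of the chord, whose increment is
    O(1/N). *)
Lemma potential_derive_bound (N : nat) (t : R) :
  0 < t <= PI / 6 ->
  Rabs (2 * log_chord t ^ 2 * (arcsin4_sum' N t - 8 / 3 * t ^ 3)
     - 2 / 3 * log_chord t ^ 4 * (arcsin2_sum' N t - 4 * t)
     - 8 / 15 * Im (arc_log t ^ 5 * arc t ^ S N))
  <= 35 * 10 ^ 5 / INR (S N) + 10 ^ 5 * ((2 * sin t) ^ N * (2 * cos t)).
Proof.
  intros Ht; destruct (arc_range t Ht) as (Hs & H1 & Hc).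
  assert (Ht' : 0 <= t <= PI / 6) by lra.
  set (l := Rabs (log_chord t)).
  assert (Hl : 0 <= l) by apply Rabs_pos.
  assert (HW : (1 + l) ^ 5 * (2 * sin t) <= 10 ^ 5).
  { eapply Rle_trans; [apply log_growth; exact Ht|].
    generalize (root_chord_bounds t Ht); lra. }
  assert (Hi : 0 < / INR (S N)) by apply Rinv_0_lt_compat, INR_S_pos.
  assert (Hpow : forall j, (j <= 5)%nat -> l ^ j * t <= 10 ^ 5).
  { intros j Hj; eapply Rle_trans; [|exact HW].
    apply Rmult_le_compat; [apply pow_le; auto|lra|apply pow_log_le; auto|lra]. }
  assert (T1 : Rabs (2 * log_chord t ^ 2 * (arcsin4_sum' N t - 8 / 3 * t ^ 3))
               <= 32 * 10 ^ 5 / INR (S N)).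
  { rewrite !Rabs_mult, <- RPow_abs, (Rabs_pos_eq 2) by lra; fold l.
    apply Rle_trans with (2 * l ^ 2 * (16 / INR (S N) * t)).
    - apply Rmult_le_compat_l; [generalize (pow2_ge_0 l); lra|apply arcsin4_sum'_approx; exact Ht'].
    - replace (2 * l ^ 2 * (16 / INR (S N) * t)) with (32 / INR (S N) * (l ^ 2 * t))
        by (unfold Rdiv; ring).
      replace (32 * 10 ^ 5 / INR (S N)) with (32 / INR (S N) * 10 ^ 5) by (unfold Rdiv; ring).
      apply Rmult_le_compat_l; [unfold Rdiv; lra|apply Hpow; lia]. }
  assert (T2 : Rabs (2 / 3 * log_chord t ^ 4 * (arcsin2_sum' N t - 4 * t))
               <= 3 * 10 ^ 5 / INR (S N)).
  { rewrite !Rabs_mult, <- RPow_abs, (Rabs_pos_eq (2 / 3)) by lra; fold l.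
    apply Rle_trans with (2 / 3 * l ^ 4 * (4 / INR (S N) * t)).
    - apply Rmult_le_compat_l; [generalize (pow_le l 4 Hl); lra|apply arcsin2_sum'_approx; exact Ht'].
    - replace (2 / 3 * l ^ 4 * (4 / INR (S N) * t)) with (8 / 3 * / INR (S N) * (l ^ 4 * t))
        by (unfold Rdiv; field; apply Rgt_not_eq, INR_S_pos).
      replace (3 * 10 ^ 5 / INR (S N)) with (3 * / INR (S N) * 10 ^ 5) by (unfold Rdiv; ring).
      apply Rmult_le_compat; [lra|apply Rmult_le_pos; [apply pow_le; auto|lra]|lra|apply Hpow; lia]. }
  assert (T3 : Rabs (8 / 15 * Im (arc_log t ^ 5 * arc t ^ S N))
               <= 10 ^ 5 * ((2 * sin t) ^ N * (2 * cos t))).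
  { rewrite Rabs_mult, (Rabs_pos_eq (8 / 15)) by lra.
    assert (I : Rabs (Im (arc_log t ^ 5 * arc t ^ S N)) <= 10 ^ 5 * (2 * sin t) ^ N).
    { eapply Rle_trans; [apply Im_le_Cmod|].
      rewrite Cmod_mult, !Cmod_pow, Cmod_arc by exact Hs.
      rewrite <- (tech_pow_Rmult (2 * sin t) N), <- Rmult_assoc.
      apply Rmult_le_compat_r; [apply pow_le; lra|].
      eapply Rle_trans; [|exact HW].
      apply Rmult_le_compat_r; [lra|].
      apply pow_incr; split; [apply Cmod_ge_0|apply Cmod_arc_log; exact Ht]. }
    assert (P : 0 <= (2 * sin t) ^ N) by (apply pow_le; lra).
    assert (Q : (2 * sin t) ^ N <= (2 * sin t) ^ N * (2 * cos t)) by nra.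
    lra. }
  unfold Rdiv in T1, T2 |- *.
  apply Rabs_le_between in T1; apply Rabs_le_between in T2; apply Rabs_le_between in T3.
  apply Rabs_le; split; lra.
Qed.

Lemma potential_increment (N : nat) (t : R) :
  0 < t <= PI / 6 ->
  Rabs (potential N (PI / 6) - potential N t) <= 36 * 10 ^ 5 / INR (S N).
Proof.
  intros Ht.
  assert (HN := INR_S_pos N).
  assert (Hi : 0 < / INR (S N)) by now apply Rinv_0_lt_compat.
  set (g := fun x => 35 * 10 ^ 5 / INR (S N) * x + 10 ^ 5 * ((2 * sin x) ^ S N / INR (S N))).
  apply Rle_trans with (g (PI / 6) - g t).
  - apply (increment_le_of_derive_le (potential N) g
      (fun t => 2 * log_chord t ^ 2 * (arcsin4_sum' N t - 8 / 3 * t ^ 3)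
        - 2 / 3 * log_chord t ^ 4 * (arcsin2_sum' N t - 4 * t)
        - 8 / 15 * Im (arc_log t ^ 5 * arc t ^ S N))
      (fun t => 35 * 10 ^ 5 / INR (S N) + 10 ^ 5 * ((2 * sin t) ^ N * (2 * cos t)))); [lra| | |].
    + intros x Hx; apply is_derive_potential, arc_range; lra.
    + intros x _; unfold g.
      apply (is_derive_plus (fun x => 35 * 10 ^ 5 / INR (S N) * x)
               (fun x => 10 ^ 5 * ((2 * sin x) ^ S N / INR (S N)))).
      * apply is_derive_linear.
      * apply is_derive_scal.
        assert (D : is_derive (fun x => 2 * sin x) x (2 * cos x)) by (auto_derive; [trivial|ring]).
        generalize (is_derive_scal_l _ _ _ (/ INR (S N)) (is_derive_pow _ (S N) _ _ D)).
        match goal with |- is_derive _ _ ?A -> is_derive _ _ ?B => replace B with A; auto end.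
        change (INR (S N) * (2 * cos x) * (2 * sin x) ^ N * / INR (S N)
                = (2 * sin x) ^ N * (2 * cos x)); field; lra.
    + intros x Hx; apply potential_derive_bound; lra.
  - destruct (arc_range t Ht) as (Hs & H1 & _).
    assert (H6 := PI6_le_1).
    unfold g; rewrite sin_PI6_half, pow1.
    assert (0 <= (2 * sin t) ^ S N) by (apply pow_le; lra).
    assert (0 <= (2 * sin t) ^ S N * / INR (S N)) by nra.
    unfold Rdiv; nra.
Qed.

Lemma div_pow_le (c k : R) (j : nat) : 1 <= k -> Rabs (c / k ^ j) <= Rabs c.
Proof.
  intros Hk; assert (H1 : 1 <= k ^ j) by (apply pow_R1_Rle; exact Hk).
  assert (H2 : 0 < / k ^ j <= 1).
  { split; [apply Rinv_0_lt_compat; lra|rewrite <- Rinv_1; apply Rinv_le_contravar; lra]. }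
  unfold Rdiv; rewrite Rabs_mult, (Rabs_pos_eq (/ k ^ j)) by lra.
  generalize (Rabs_pos c); nra.
Qed.

Lemma log_weights_le (k t : R) :
  1 <= k ->
  Rabs (log_weight4 k t) <= 7 * (1 + Rabs (log_chord t)) ^ 5 /\
  Rabs (log_weight6 k t) <= 7 * (1 + Rabs (log_chord t)) ^ 5.
Proof.
  intros Hk; unfold log_weight4, log_weight6.
  set (l := log_chord t); assert (Hl : 0 <= Rabs l) by apply Rabs_pos.
  assert (B : forall c i j, (i <= 5)%nat ->
             Rabs (c * l ^ i / k ^ j) <= Rabs c * (1 + Rabs l) ^ 5).
  { intros c i j Hi; eapply Rle_trans; [apply div_pow_le; exact Hk|].
    rewrite Rabs_mult, <- RPow_abs; apply Rmult_le_compat_l; [apply Rabs_pos|].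
    now apply pow_log_le. }
  split.
  - replace (1 / k ^ 2 - 2 * l / k + 2 * l ^ 2)
      with (1 * l ^ 0 / k ^ 2 - 2 * l ^ 1 / k ^ 1 + 2 * l ^ 2 / k ^ 0) by (field; lra).
    generalize (B 1 0%nat 2%nat ltac:(lia)) (B 2 1%nat 1%nat ltac:(lia))
      (B 2 2%nat 0%nat ltac:(lia)).
    rewrite Rabs_R1, (Rabs_pos_eq 2) by lra; intros B1 B2 B3.
    apply Rabs_le_between in B1; apply Rabs_le_between in B2; apply Rabs_le_between in B3.
    apply Rabs_le; split; lra.
  - replace (1 / k ^ 4 - 2 * l / k ^ 3 + 2 * l ^ 2 / k ^ 2 - 4 / 3 * l ^ 3 / k + 2 / 3 * l ^ 4)
      with (1 * l ^ 0 / k ^ 4 - 2 * l ^ 1 / k ^ 3 + 2 * l ^ 2 / k ^ 2 - 4 / 3 * l ^ 3 / k ^ 1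
            + 2 / 3 * l ^ 4 / k ^ 0) by (field; lra).
    generalize (B 1 0%nat 4%nat ltac:(lia)) (B 2 1%nat 3%nat ltac:(lia))
      (B 2 2%nat 2%nat ltac:(lia)) (B (4 / 3) 3%nat 1%nat ltac:(lia))
      (B (2 / 3) 4%nat 0%nat ltac:(lia)).
    rewrite Rabs_R1, (Rabs_pos_eq 2), (Rabs_pos_eq (4 / 3)), (Rabs_pos_eq (2 / 3)) by lra.
    intros B1 B2 B3 B4 B5.
    apply Rabs_le_between in B1; apply Rabs_le_between in B2; apply Rabs_le_between in B3.
    apply Rabs_le_between in B4; apply Rabs_le_between in B5.
    apply Rabs_le; split; lra.
Qed.

Lemma Cmod_log_poly_le (k l : R) (z : C) :
  1 <= k -> 0 <= l -> Cmod z <= 1 + l -> Cmod (log_poly k z) <= 326 * (1 + l) ^ 5.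
Proof.
  intros Hk Hl Hz; assert (Hk' : k <> 0) by lra.
  assert (B : forall c i j, (i <= 5)%nat ->
             Cmod (RtoC (c / k ^ j) * z ^ i) <= Rabs c * (1 + l) ^ 5).
  { intros c i j Hi; rewrite Cmod_mult, Cmod_R, Cmod_pow.
    apply Rmult_le_compat; [apply Rabs_pos|apply pow_le, Cmod_ge_0|apply div_pow_le; exact Hk|].
    apply Rle_trans with ((1 + l) ^ i); [apply pow_incr; split; [apply Cmod_ge_0|exact Hz]|].
    apply Rle_pow; [lra|exact Hi]. }
  replace (log_poly k z) with
    (RtoC (1 / k ^ 1) * z ^ 5 + (RtoC (-5 / k ^ 2) * z ^ 4 + (RtoC (20 / k ^ 3) * z ^ 3
     + (RtoC (-60 / k ^ 4) * z ^ 2 + (RtoC (120 / k ^ 5) * z ^ 1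
     + RtoC (-120 / k ^ 6) * z ^ 0)))))%C.
  2:{ unfold log_poly; rewrite !RtoC_div, !RtoC_pow by (apply pow_nonzero; exact Hk').
      assert (RtoC k <> 0%C) by (intros E; apply Hk'; now injection E).
      field; auto. }
  generalize (B 1 5%nat 1%nat ltac:(lia)) (B (-5) 4%nat 2%nat ltac:(lia))
    (B 20 3%nat 3%nat ltac:(lia)) (B (-60) 2%nat 4%nat ltac:(lia))
    (B 120 1%nat 5%nat ltac:(lia)) (B (-120) 0%nat 6%nat ltac:(lia)).
  rewrite Rabs_R1, (Rabs_left (-5)), (Rabs_pos_eq 20), (Rabs_left (-60)), (Rabs_pos_eq 120),
    (Rabs_left (-120)) by lra.
  intros B1 B2 B3 B4 B5 B6.
  assert (T : forall a b A B, Cmod a <= A -> Cmod b <= B -> Cmod (a + b) <= A + B).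
  { intros a b A B' Ha Hb; eapply Rle_trans; [apply Cmod_triangle|lra]. }
  eapply Rle_trans; [do 5 (apply T; [eassumption|]); eassumption|lra].
Qed.

Lemma sum_bound (f : nat -> R -> R) (g : R -> R) (D : R -> Prop) (N : nat) :
  (forall n, exists K, forall t, D t -> Rabs (f n t) <= K * g t) ->
  exists K, forall t, D t -> Rabs (sum_n (fun n => f n t) N) <= K * g t.
Proof.
  intros H; induction N as [|N [K HK]].
  - destruct (H O) as [K HK]; exists K; intros t Ht; rewrite sum_n_0; auto.
  - destruct (H (S N)) as [K' HK']; exists (K + K'); intros t Ht.
    rewrite sum_n_S, Rmult_plus_distr_r.
    eapply Rle_trans; [apply Rabs_triang|apply Rplus_le_compat; auto].
Qed.

Lemma chord_pow_le (n : nat) (t : R) :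
  0 < t <= PI / 6 -> 0 <= chord_pow n t <= 2 * sin t.
Proof.
  intros Ht; destruct (arc_range t Ht) as (Hs & H1 & _).
  unfold chord_pow, chord_sq; rewrite <- pow_mult.
  split; [apply pow_le; lra|].
  rewrite <- (pow_1 (2 * sin t)) at 2.
  replace (2 * S n)%nat with (S (S (2 * n))) by lia.
  assert (P : 0 <= (2 * sin t) ^ (S (2 * n)) <= 1).
  { split; [apply pow_le; lra|rewrite <- (pow1 (S (2 * n))); apply pow_incr; lra]. }
  rewrite <- (tech_pow_Rmult _ (S (2 * n))), pow_1; nra.
Qed.

Lemma log_growth_bound (x y t : R) :
  0 < t <= PI / 6 -> 0 <= x <= 2 * sin t ->
  Rabs y <= 7 * (1 + Rabs (log_chord t)) ^ 5 ->
  Rabs (x * y) <= 7 * 10 ^ 5 * root_chord t.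
Proof.
  intros Ht Hx Hy; assert (G := log_growth t Ht).
  rewrite Rabs_mult, (Rabs_pos_eq x) by lra.
  apply Rle_trans with (2 * sin t * (7 * (1 + Rabs (log_chord t)) ^ 5)); [|lra].
  apply Rmult_le_compat; try apply Rabs_pos; lra.
Qed.

Lemma potential_small (N : nat) :
  exists K, forall t, 0 < t <= PI / 6 -> Rabs (potential N t) <= K * root_chord t.
Proof.
  destruct (sum_bound (fun n t => S2 n * arcsin_coef n * (chord_pow n t * log_weight4 (INR (S n)) t)
                  - arcsin_coef n * (chord_pow n t * log_weight6 (INR (S n)) t))
              root_chord (fun t => 0 < t <= PI / 6) N) as [K1 B1].
  { intros n.
    exists ((Rabs (S2 n * arcsin_coef n) + Rabs (arcsin_coef n)) * (7 * 10 ^ 5)); intros t Ht.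
    destruct (log_weights_le (INR (S n)) t (INR_S_ge_1 n)) as [W4 W6].
    assert (H4 := log_growth_bound _ _ t Ht (chord_pow_le n t Ht) W4).
    assert (H6 := log_growth_bound _ _ t Ht (chord_pow_le n t Ht) W6).
    unfold Rminus; eapply Rle_trans; [apply Rabs_triang|].
    rewrite Rabs_Ropp, !(Rabs_mult _ (chord_pow n t * _)), Rmult_assoc, Rmult_plus_distr_r.
    apply Rplus_le_compat; apply Rmult_le_compat_l; try apply Rabs_pos; assumption. }
  destruct (sum_bound (fun n t => Re (arc t ^ S n * log_poly (INR (S n)) (arc_log t)))
              root_chord (fun t => 0 < t <= PI / 6) N) as [K2 B2].
  { intros n; exists (326 * 10 ^ 5); intros t Ht.
    destruct (arc_range t Ht) as (Hs & H1 & _).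
    eapply Rle_trans; [apply re_le_Cmod|].
    rewrite Cmod_mult, Cmod_pow, Cmod_arc by exact Hs.
    assert (Q := Cmod_log_poly_le (INR (S n)) (Rabs (log_chord t)) (arc_log t)
                   (INR_S_ge_1 n) (Rabs_pos _) (Cmod_arc_log t Ht)).
    assert (G := log_growth t Ht).
    assert (P : 0 <= (2 * sin t) ^ n <= 1).
    { split; [apply pow_le; lra|rewrite <- (pow1 n); apply pow_incr; lra]. }
    apply Rle_trans with (2 * sin t * (326 * (1 + Rabs (log_chord t)) ^ 5)); [|lra].
    apply Rmult_le_compat; [apply pow_le; lra|apply Cmod_ge_0| |exact Q].
    rewrite <- tech_pow_Rmult; nra. }
  exists (K1 + (4 / 15 * K2 + 8 / 90)); intros t Ht.
  destruct (arc_range t Ht) as (Hs & H1 & _).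
  generalize (B1 t Ht) (B2 t Ht) (root_chord_bounds t Ht) (root_chord_sq t Hs).
  change (sum_n (fun n => S2 n * arcsin_coef n * (chord_pow n t * log_weight4 (INR (S n)) t)
                  - arcsin_coef n * (chord_pow n t * log_weight6 (INR (S n)) t)) N)
    with (series_part N t).
  change (sum_n (fun n => Re (arc t ^ S n * log_poly (INR (S n)) (arc_log t))) N)
    with (arc_sum N t).
  intros C1 C2 C3 C4.
  assert (C5 : 0 <= t ^ 6 <= root_chord t).
  { split; [apply pow_le; lra|].
    assert (H6 := PI6_le_1).
    assert (t ^ 5 <= 1) by (rewrite <- (pow1 5); apply pow_incr; lra).
    assert (0 <= t ^ 5) by (apply pow_le; lra).
    rewrite <- (tech_pow_Rmult t 5); nra. }
  unfold potential.
  apply Rabs_le_between in C1; apply Rabs_le_between in C2.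
  apply Rabs_le; split; lra.
Qed.

(** The estimate from [t] to [PI/6] is uniform in [t]; let [t] tend to 0 with [N] fixed. *)
Lemma potential_PI6_small (N : nat) : Rabs (potential N (PI / 6)) <= 36 * 10 ^ 5 / INR (S N).
Proof.
  destruct (potential_small N) as [K HK].
  apply le_epsilon; intros eps Heps.
  set (K' := Rabs K + 1); assert (HK' : 0 < K') by (unfold K'; generalize (Rabs_pos K); lra).
  (* At t = tau^2 / 2 the gauge root_chord is at most tau. *)
  set (tau := Rmin 1 (eps / K')).
  assert (Htau : 0 < tau <= 1).
  { split; [apply Rmin_pos; [lra|apply Rdiv_lt_0_compat; lra]|apply Rmin_l]. }
  assert (HP := PI2_3_2).
  assert (Ht : 0 < tau ^ 2 / 2 <= PI / 6) by nra.
  destruct (arc_range _ Ht) as (Hs & _ & _).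
  assert (Hr : root_chord (tau ^ 2 / 2) <= tau).
  { assert (B : 2 * sin (tau ^ 2 / 2) <= tau ^ 2) by (generalize (sin_lt_x _ (proj1 Ht)); lra).
    rewrite <- (root_chord_sq _ Hs) in B.
    generalize (root_chord_bounds _ Ht); nra. }
  assert (B1 := potential_increment N _ Ht).
  assert (B2 := HK _ Ht).
  assert (B3 : K * root_chord (tau ^ 2 / 2) <= eps).
  { apply Rle_trans with (K' * (eps / K')); [|right; field; lra].
    apply Rle_trans with (K' * root_chord (tau ^ 2 / 2)).
    - apply Rmult_le_compat_r; [generalize (root_chord_bounds _ Ht); lra|].
      unfold K'; generalize (Rle_abs K); lra.
    - apply Rmult_le_compat_l; [lra|].
      eapply Rle_trans; [exact Hr|apply Rmin_r]. }
  replace (potential N (PI / 6))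
    with ((potential N (PI / 6) - potential N (tau ^ 2 / 2)) + potential N (tau ^ 2 / 2)) by ring.
  eapply Rle_trans; [apply Rabs_triang|lra].
Qed.

(** * The sum of the series *)

(* [is_series a l] sums [a n] over n >= 0; the sum over k >= 1 is taken with k = S n.
   [Binomial.C] is the binomial coefficient (plain [C] is Coquelicot's type of complex numbers). *)
Theorem mainTheorem17 :
  is_series
    (fun n : nat =>
       let k := S n in
       (S2 (k - 1) - 1 / INR k ^ 2) / (INR k ^ 4 * Binomial.C (2 * k) k))
    (- (313 * PI ^ 6 / 612360)).
Proof.
  match goal with |- is_series ?a ?l => change (is_lim_seq (sum_n a) (Finite l)) end.
  apply (is_lim_seq_ext (fun N => series_part N (PI / 6))).
  { intros N; apply sum_n_ext; intros n.
    match goal with |- ?x = ?y => change (x = y :> R) end; cbv zeta.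
    replace (S n - 1)%nat with n by lia.
    assert (Hc : chord_pow n (PI / 6) = 1)
      by (unfold chord_pow, chord_sq; rewrite sin_PI6_half, !pow1; reflexivity).
    unfold log_weight4, log_weight6; rewrite Hc, log_chord_PI6.
    unfold arcsin_coef; generalize (INR_S_pos n) (central_binom_ge (S n)) (INR_S_pos (S n)).
    unfold central_binom; intros; field; lra. }
  apply (is_lim_seq_ext (fun N => potential N (PI / 6)
           - (4 / 15 * arc_sum N (PI / 6) - 8 / 90 * (PI / 6) ^ 6)));
    [intros N; unfold potential; ring|].
  replace (- (313 * PI ^ 6 / 612360))
    with (0 - (4 / 15 * (15 / 4 * (8 / 90 * (PI / 6) ^ 6 + 313 * PI ^ 6 / 612360))
               - 8 / 90 * (PI / 6) ^ 6)) by field.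
  apply is_lim_seq_minus'.
  - apply (is_lim_seq_of_abs_le _ (fun N => 36 * 10 ^ 5 / INR (S N))).
    + intros N; rewrite Rminus_0_r; apply potential_PI6_small.
    + apply is_lim_seq_const_div_S.
  - apply is_lim_seq_minus'; [|apply is_lim_seq_const].
    apply (is_lim_seq_scal_l _ (4 / 15) (Finite _) arc_sum_limit).
Qed.
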